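(* Let $Q$ be a cyclic hyperbolic quadrilateral with side lengths $a,b,c,d$. Then the area $S=S(Q)$ is given by the formula $$\tan^2\frac{S}{4}=\frac{1}{1-\varepsilon}\tanh\frac{s-a}{2}\tanh\frac{s-b}{2}\tanh\frac{s-c}{2}\tanh\frac{s-d}{2},$$ where $$\varepsilon=\frac{\sinh\frac{a}{2}\sinh\frac{b}{2}\sinh\frac{c}{2}\sinh\frac{d}{2}}{\cosh\frac{s-a}{2}\cosh\frac{s-b}{2}\cosh\frac{s-c}{2}\cosh\frac{s-d}{2}}\quad\text{and}\quad s=\frac{a+b+c+d}{2}.$$
   Context: The hyperbolic plane carries the Riemannian metric of constant curvature $-1$. A cyclic polygon in the hyperbolic plane is a convex polygon inscribed in a circle, a horocycle, or one branch of an equidistant curve. *)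

(* Defs.v *)
From HB Require Import structures.
From mathcomp Require Import all_boot all_order all_algebra.
From mathcomp Require Import all_classical all_reals all_analysis.

Set Implicit Arguments.
Unset Strict Implicit.
Unset Printing Implicit Defensive.

Import Order.TTheory GRing.Theory Num.Theory.
Import numFieldNormedType.Exports.

Local Open Scope classical_set_scope.
Local Open Scope ring_scope.

Definition sinh {R : realType} (x : R) : R := (expR x - expR (- x)) / 2.
Definition cosh {R : realType} (x : R) : R := (expR x + expR (- x)) / 2.
Definition tanh {R : realType} (x : R) : R := sinh x / cosh x.
Definition arcosh {R : realType} (x : R) : R := ln (x + Num.sqrt (x ^+ 2 - 1)).

(* The hyperbolic plane is the Poincare upper half-plane {(x, y) | y > 0} with
   the metric (dx^2 + dy^2) / y^2, of curvature -1.  [hdist] is its distance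
   function (meaningful on points of [hplane]) and [harea] its area measure,
   with density dx dy / y^2. *)
Definition hplane {R : realType} : set (R * R) := [set z | 0 < z.2].

Definition hdist {R : realType} (z w : R * R) : R :=
  arcosh (1 + ((z.1 - w.1) ^+ 2 + (z.2 - w.2) ^+ 2) / (2 * z.2 * w.2)).

Definition harea {R : realType} (Q : set (R * R)) : R :=
  \int[(@lebesgue_measure R \x @lebesgue_measure R)%E]_(z in Q) (z.2 ^- 2).

(* The geodesics are the vertical half-lines and the half-circles centred on
   the real axis: the zero sets in [hplane] of the functions
   a (x^2 + y^2) + b x + c with b^2 - 4 a c > 0.  The sign of the function
   selects one of the two sides of the geodesic. *)
Record halfplane (R : realType) := HalfPlane {
  hp_a : R;
  hp_b : R;
  hp_c : R;
  hp_disc : 0 < hp_b ^+ 2 - 4 * hp_a * hp_c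
}.

Definition hp_fun {R : realType} (h : halfplane R) (z : R * R) : R :=
  hp_a h * (z.1 ^+ 2 + z.2 ^+ 2) + hp_b h * z.1 + hp_c h.

Definition geodesic {R : realType} (h : halfplane R) : set (R * R) :=
  hplane `&` [set z | hp_fun h z = 0].
Definition open_halfplane {R : realType} (h : halfplane R) : set (R * R) :=
  hplane `&` [set z | 0 < hp_fun h z].
Definition closed_halfplane {R : realType} (h : halfplane R) : set (R * R) :=
  hplane `&` [set z | 0 <= hp_fun h z].

(* [Q] is a (nondegenerate) convex polygon with vertices P_0, ..., P_(n-1) in
   cyclic order: the intersection of n closed half-planes h_i, where the
   boundary of h_i passes through P_i and P_(i+1) and all the other vertices
   are in the interior of h_i. *)
Definition convex_polygon {R : realType} (n : nat)
    (Q : set (R * R)) (P : 'I_n -> R * R) : Prop :=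
  (2 < n)%N /\
  exists h : 'I_n -> halfplane R,
    [/\ forall i, geodesic (h i) (P i),
        forall i, geodesic (h i) (P (ordS i)),
        forall i j, j != i -> j != ordS i -> open_halfplane (h i) (P j)
      & Q = \bigcap_i closed_halfplane (h i)].

Definition side_length {R : realType} (n : nat) (P : 'I_n -> R * R) (i : 'I_n) : R :=
  hdist (P i) (P (ordS i)).

Definition is_circle {R : realType} (C : set (R * R)) : Prop :=
  exists (o : R * R) (r : R),
    [/\ hplane o, 0 < r & C = hplane `&` [set z | hdist o z = r]].

(* Horocycles centred at the ideal point oo are the horizontal lines; those
   centred at the ideal point xi are the Euclidean circles tangent to the real
   axis at xi, without the point of tangency. *)
Definition is_horocycle {R : realType} (C : set (R * R)) : Prop :=
  (exists k : R, 0 < k /\ C = [set z | z.2 = k]) \/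
  (exists xi rho : R, 0 < rho /\
     C = hplane `&` [set z | (z.1 - xi) ^+ 2 + (z.2 - rho) ^+ 2 = rho ^+ 2]).

(* One branch of an equidistant curve: the points at a given distance r > 0
   from a geodesic, on one given side of it. *)
Definition is_equidistant_branch {R : realType} (C : set (R * R)) : Prop :=
  exists (h : halfplane R) (r : R), 0 < r /\
    C = open_halfplane h `&`
        [set z | inf [set hdist z w | w in geodesic h] = r].

Definition cyclic_polygon {R : realType} (n : nat)
    (Q : set (R * R)) (P : 'I_n -> R * R) : Prop :=
  convex_polygon Q P /\
  exists C : set (R * R),
    (is_circle C \/ is_horocycle C \/ is_equidistant_branch C) /\
    forall i, C (P i).

(* Main.v *)
Require Import Defs.
From mathcomp Require Import all_boot all_order all_algebra.
From mathcomp Require Import all_classical all_reals all_analysis.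
From mathcomp Require Import measurable_realfun ring lra.
Import Order.TTheory GRing.Theory Num.Theory.
Import numFieldNormedType.Exports.
Local Open Scope ring_scope.

Set Implicit Arguments.
Unset Strict Implicit.
Unset Printing Implicit Defensive.
Local Open Scope classical_set_scope.

(** Write z_j = x_j + i y_j for the vertices in the upper half-plane.

    Area.  Since d(dx / y) = dx dy / y^2, the area of a region is the boundary
    integral of dx / y.  Along the geodesic from z to w this integral is
    2 atan ((w.1 - z.1) / (z.2 + w.2)), the quantity [edge_angle] below: with
    centre m, radius r and angles th, th' at z and w, it equals th - th', and
    z - conj w has argument pi / 2 + (th - th') / 2.  So S is, up to the sign
    given by the orientation, twice the sum of the arguments of the four
    complex numbers (y_j + y_(j+1)) + i (x_(j+1) - x_j), whose moduli are
    2 sqrt (y_j y_(j+1)) cosh (a_j / 2); hence cos (S / 2) is an algebraic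
    function of the coordinates ([cos_edge_angles]).  The boundary integral is
    made rigorous without Green's theorem.  In the coordinates
    (x, x^2 + y^2) geodesics become straight chords and vertical lines stay
    vertical, so [gdet], the orientation determinant in these coordinates,
    reduces the plane geometry to affine geometry.  The part of the plane above
    an edge has area equal to its [edge_angle] ([hvol_above], by Tonelli and
    the fundamental theorem of calculus); a triangle is a signed union of such
    parts ([hvol_triangle]) and a convex quadrilateral is a union of two
    triangles ([hvol_quadrangle]).

    Cyclicity.  Circles, horocycles and branches of equidistant curves all lie
    on Euclidean circles or lines ([cycle_circline]), so the cross-ratio
    product (z0 - z1) (z2 - z3) conj ((z1 - z2) (z3 - z0)) is real; convexity
    makes it negative ([circline_cross]).  Its value is thus minus the product
    of the four Euclidean side lengths, which is
    - 16 y_0 y_1 y_2 y_3 sinh (a/2) sinh (b/2) sinh (c/2) sinh (d/2).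

    Conclusion.  Put K, H for the products of cosh ((s - a) / 2), ... and of
    sinh ((s - a) / 2), ..., and G for the product of sinh (a / 2), ....  The
    formula for cos (S / 2) becomes
      cos (S / 2) = (1 + (sinh^2 (a/2) + ...) / 2 - G) / prod cosh (a/2),
    and addition theorems turn the numerator into K - H - G and the denominator
    into K + H - G ([prod_half_sums]).  Then
    tan^2 (S / 4) = (1 - cos (S / 2)) / (1 + cos (S / 2)) = H / (K - G), which
    is the right-hand side of the theorem since epsilon = G / K. *)

(** * Hyperbolic area as a measure *)

(** The extended-real form of [harea]: additivity and the fundamental theorem
    of calculus live there, and finiteness comes out of the computation. *)
Definition hvol {R : realType} (A : set (R * R)) : \bar R :=
  (\int[lebesgue_measure \x lebesgue_measure]_(z in A) (z.2 ^- 2)%:E)%E.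

(** Inversion is discontinuous at 0, so the density is written as a real power;
    both conventions at 0 give the value 0. *)
Lemma measurable_density (R : realType) (D : set (R * R)) :
  measurable_fun D (EFin \o (fun z : R * R => z.2 ^- 2)).
Proof.
apply: measurable_funTS; apply/measurable_EFinP.
rewrite (_ : (fun _ => _) = (fun z : R * R => (z.2 ^+ 2) `^ (-1))); last first.
  by apply/funext => z; rewrite powR_inv1 ?sqr_ge0// exprVn.
apply: (measurableT_comp (measurable_powR _)).
by apply: measurable_funX; exact: measurable_snd.
Qed.

Lemma density_ge0 (R : realType) (z : R * R) : (0 <= (z.2 ^- 2)%:E)%E.
Proof. by rewrite lee_fin invr_ge0 sqr_ge0. Qed.

Lemma hvolU (R : realType) (A B : set (R * R)) :
  measurable A -> measurable B -> A `&` B = set0 ->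
  hvol (A `|` B) = (hvol A + hvol B)%E.
Proof.
move=> mA mB AB; apply: ge0_integral_setU => //.
- exact: measurable_density.
- by move=> *; exact: density_ge0.
- by rewrite disj_set2E AB.
Qed.

Definition hline {R : realType} (a b c : R) (z : R * R) : R :=
  a * (z.1 ^+ 2 + z.2 ^+ 2) + b * z.1 + c.

Lemma measurable_hline (R : realType) (a b c : R) (D : set (R * R)) :
  measurable_fun D (hline a b c).
Proof.
apply: measurable_funTS.
apply: measurable_funD => //; apply: measurable_funD; last first.
  by apply: measurable_funM => //; exact: measurable_fst.
apply: measurable_funM => //; apply: measurable_funD;
  apply: measurable_funX; solve [exact: measurable_fst|exact: measurable_snd].
Qed.

Lemma measurable_hline_ge0 (R : realType) (a b c : R) :
  measurable [set z : R * R | 0 <= hline a b c z].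
Proof.
rewrite -[X in measurable X]setTI; apply: measurable_fun_le => //.
exact: measurable_hline.
Qed.

Lemma measurable_hline_eq0 (R : realType) (a b c : R) :
  measurable [set z : R * R | hline a b c z = 0].
Proof.
have -> : [set z : R * R | hline a b c z = 0] =
  [set z | 0 <= hline a b c z] `&` [set z | 0 <= hline (- a) (- b) (- c) z].
  apply/seteqP; split => z /=; rewrite /hline; last by move=> []; lra.
  by move=> ?; split; lra.
by apply: measurableI; exact: measurable_hline_ge0.
Qed.

Lemma measurable_hplane (R : realType) : measurable (@hplane R).
Proof.
rewrite /hplane.
have -> : [set z : R * R | 0 < z.2] = ~` [set z | z.2 <= 0].
  by apply/seteqP; split => z /=; rewrite ltNge => /negP.
apply: measurableC; rewrite -[X in measurable X]setTI.
by apply: measurable_fun_le => //; exact: measurable_snd.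
Qed.

Lemma hline_section (R : realType) (a b c x y : R) : a != 0 -> 0 < y ->
  hline a b c (x, y) = 0 -> y = Num.sqrt (- (b * x + c) / a - x ^+ 2).
Proof.
move=> a0 y0; rewrite /hline /= => h.
rewrite -[LHS](ger0_norm (ltW y0)) -sqrtr_sqr; congr Num.sqrt.
have -> : b * x + c = - a * (x ^+ 2 + y ^+ 2) by lra.
by field.
Qed.

(** A vertical geodesic is a null product set; any other geodesic meets each
    vertical line in at most one point. *)
Lemma hvol_geodesic (R : realType) (a b c : R) : (a != 0) || (b != 0) ->
  hvol (hplane `&` [set z | hline a b c z = 0]) = 0%E.
Proof.
move=> ab.
have mZ : measurable (@hplane R `&` [set z | hline a b c z = 0]).
  by apply: measurableI; [exact: measurable_hplane|exact: measurable_hline_eq0].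
apply: null_set_integral => //; first exact: measurable_density.
have [a0|a0] := eqVneq a 0.
  have b0 : b != 0 by rewrite a0 eqxx in ab.
  apply/eqP; rewrite eq_le measure_ge0 andbT.
  rewrite -(_ : (lebesgue_measure \x lebesgue_measure)%E
     ([set (- c / b : R)] `*` [set: R]) = 0%E); last first.
    by rewrite product_measure1E//= lebesgue_measure_set1 mul0e.
  apply: le_measure; rewrite ?inE//; first exact: measurableX.
  move=> z [_]; rewrite /= /hline a0 => h; split => //=.
  apply: (mulIf b0); rewrite mulfVK//; lra.
rewrite /= /product_measure1 integral0_eq// => x _ /=.
apply/eqP; rewrite eq_le measure_ge0 andbT.
rewrite -(lebesgue_measure_set1 (Num.sqrt (- (b * x + c) / a - x ^+ 2))).
apply: le_measure; rewrite ?inE//; first exact: measurable_xsection.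
move=> y; rewrite /xsection /= inE => -[/= y_gt0 h].
exact: hline_section.
Qed.

(** * Area above a geodesic edge *)

Lemma is_derive_cvg (R : realType) (f : R -> R) (x d : R) :
  is_derive x 1 f d -> f t @[t --> x] --> f x.
Proof.
move=> [df _]; have : {for x, continuous f}.
  exact/differentiable_continuous/derivable1_diffP.
by [].
Qed.

(** Inner integral of Tonelli's theorem: the part of a vertical line above
    height l. *)
Lemma integral_invsqr_above (R : realType) (l : R) : 0 < l ->
  (\int[lebesgue_measure]_(y in `[l, +oo[) (y ^- 2)%:E = (l^-1)%:E)%E.
Proof.
move=> l0.
have gt0 (y : R) : l <= y -> 0 < y by exact: lt_le_trans.
have dF (y : R) : 0 < y -> is_derive y 1 (fun t : R => - t^-1) (y ^- 2).
  move=> y0.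
  have dV : is_derive y 1 (fun t : R => t^-1) (- y ^- 2 *: 1).
    exact: (@is_deriveV R id y 1 1 (lt0r_neq0 y0) _).
  apply: is_derive_eq; rewrite /GRing.scale/=; ring.
rewrite (@ge0_continuous_FTC2y R _ (fun t => - t^-1) l 0)//.
- by rewrite -EFinB sub0r opprK.
- by move=> y _; rewrite invr_ge0 sqr_ge0.
- apply: derivable_within_continuous => y; rewrite in_itv/= andbT => /gt0 y0.
  apply: derivableV; first by rewrite expf_neq0// gt_eqF.
  exact: exprn_derivable.
- rewrite -[X in _ --> X]oppr0; apply: cvgN; apply/gtr0_cvgV0 => //.
  by exists 0; split.
- by move=> y ly; apply: ex_derive; apply: dF; apply: gt0; exact: ltW.
- by apply: cvg_at_right_filter; exact: is_derive_cvg (dF l l0).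
- move=> y; rewrite in_itv/= andbT => /ltW/gt0 y0.
  by rewrite derive1E; apply: derive_val; exact: dF.
Qed.

(** With al and be the slope and intercept of a chord in the coordinates
    (x, x^2 + y^2), the square root is the height of the geodesic over t. *)
Lemma is_derive_height (R : realType) (al be x : R) :
  0 < al * x + be - x ^+ 2 ->
  is_derive x 1 (fun t => Num.sqrt (al * t + be - t ^+ 2))
    ((al - 2 * x) / (2 * Num.sqrt (al * x + be - x ^+ 2))).
Proof.
move=> gx.
have dg : is_derive x 1 (fun t => al * t + be - t ^+ 2) (al - 2 * x).
  apply: is_derive_eq; rewrite /GRing.scale/=; ring.
have := @is_derive1_comp R Num.sqrt (fun t => al * t + be - t ^+ 2) x _ _
  (is_derive1_sqrt gx) dg.
by rewrite mulrC.
Qed.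

(** The candidate antiderivative is the closed form of the integral of dx / y
    from x0 to t; it avoids centres and radii and so needs no case distinction
    on the geodesic. *)
Lemma is_derive_subtended (R : realType) (al be x0 x : R) :
  let h t := Num.sqrt (al * t + be - t ^+ 2) in
  0 < al * x0 + be - x0 ^+ 2 -> 0 < al * x + be - x ^+ 2 ->
  is_derive x 1 (fun t => 2 * atan ((t - x0) / (h t + h x0))) (h x)^-1.
Proof.
move=> h g0 gx.
have h0 : 0 < h x0 by rewrite sqrtr_gt0.
have hx : 0 < h x by rewrite sqrtr_gt0.
have hx2 : h x ^+ 2 = al * x + be - x ^+ 2 by rewrite sqr_sqrtr// ltW.
have h02 : h x0 ^+ 2 = al * x0 + be - x0 ^+ 2 by rewrite sqr_sqrtr// ltW.
have dh : is_derive x 1 h ((al - 2 * x) / (2 * h x)) by exact: is_derive_height.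
have s0 : h x + h x0 != 0 by rewrite gt_eqF// addr_gt0.
have ds : is_derive x 1 (fun t => h t + h x0) ((al - 2 * x) / (2 * h x)).
  by apply: is_derive_eq; rewrite addr0.
have dV := @is_deriveV R (fun t => h t + h x0) x _ 1 s0 ds.
have dq : is_derive x 1 (fun t => (t - x0) * (h t + h x0)^-1)
  ((h x + h x0)^-1 - (x - x0) * ((al - 2 * x) / (2 * h x)) * (h x + h x0) ^- 2).
  apply: is_derive_eq; rewrite /GRing.scale/=; field.
  by rewrite s0 gt_eqF.
have da := @is_derive1_comp R atan (fun t => (t - x0) * (h t + h x0)^-1) x _ _
  (is_derive1_atan _) dq.
apply: is_derive_eq; rewrite /GRing.scale/=.
have e : 2 * h x * (h x + h x0) - (x - x0) * (al - 2 * x) =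
    (h x + h x0) ^+ 2 + (x - x0) ^+ 2 by lra.
have n0 : (h x + h x0) ^+ 2 + (x - x0) ^+ 2 != 0.
  by rewrite gt_eqF// ltr_pwDl ?sqr_ge0// exprn_gt0// addr_gt0.
move: e n0 s0 hx; clear; move: (h x) (h x0) => H K e n0 s0 H0.
have -> : (H + K)^-1 - (x - x0) * ((al - 2 * x) / (2 * H)) * (H + K) ^- 2 =
    ((H + K) ^+ 2 + (x - x0) ^+ 2) / (2 * H * (H + K) ^+ 2).
  by rewrite -e; field; rewrite s0 gt_eqF.
field.
by rewrite n0 s0 gt_eqF.
Qed.

Lemma continuous_inv_height (R : realType) (al be x1 x2 : R) :
  (forall x, x1 <= x <= x2 -> 0 < al * x + be - x ^+ 2) ->
  {within `[x1, x2], continuous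
    (fun t => (Num.sqrt (al * t + be - t ^+ 2))^-1)}.
Proof.
move=> g0; apply: derivable_within_continuous => x; rewrite in_itv/= => /g0 gx.
apply: derivableV; first by rewrite gt_eqF// sqrtr_gt0.
by have [] := is_derive_height gx.
Qed.

Lemma integral_inv_height (R : realType) (al be x1 x2 : R) :
  let h t := Num.sqrt (al * t + be - t ^+ 2) in
  x1 < x2 ->
  (forall x, x1 <= x <= x2 -> 0 < al * x + be - x ^+ 2) ->
  (\int[lebesgue_measure]_(x in `[x1, x2]) ((h x)^-1)%:E =
   (2 * atan ((x2 - x1) / (h x1 + h x2)))%:E)%E.
Proof.
move=> h x12 g0.
have g1 : 0 < al * x1 + be - x1 ^+ 2 by apply: g0; rewrite lexx ltW.
pose F t := 2 * atan ((t - x1) / (h t + h x1)).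
have dF x : x1 <= x <= x2 -> is_derive x 1 F (h x)^-1.
  by move=> /g0 gx; exact: is_derive_subtended.
rewrite (@continuous_FTC2 R _ F)//.
- by rewrite -EFinB /F subrr mul0r atan0 mulr0 subr0 (addrC (h x1)).
- exact: continuous_inv_height.
- split.
  + move=> x; rewrite in_itv/= => /andP[a b].
    have xI : x1 <= x <= x2 by rewrite !ltW.
    by have [] := dF x xI.
  + by apply: cvg_at_right_filter; apply: is_derive_cvg (dF _ _); rewrite lexx ltW.
  + by apply: cvg_at_left_filter; apply: is_derive_cvg (dF _ _); rewrite lexx ltW.
- move=> x; rewrite in_itv/= => /andP[a b]; rewrite derive1E; apply: derive_val.
  by apply: dF; rewrite !ltW.
Qed.

(** Twice the signed area of the triangle with vertices p, q, z in the
    coordinates (x, x^2 + y^2), in which geodesics are straight. *)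
Definition gdet {R : realType} (p q z : R * R) : R :=
  (q.1 - p.1) * (z.1 ^+ 2 + z.2 ^+ 2 - (p.1 ^+ 2 + p.2 ^+ 2)) -
  (q.1 ^+ 2 + q.2 ^+ 2 - (p.1 ^+ 2 + p.2 ^+ 2)) * (z.1 - p.1).

Lemma gdet_hline (R : realType) (p q z : R * R) : gdet p q z =
  hline (q.1 - p.1) (- (q.1 ^+ 2 + q.2 ^+ 2 - (p.1 ^+ 2 + p.2 ^+ 2)))
    ((q.1 ^+ 2 + q.2 ^+ 2 - (p.1 ^+ 2 + p.2 ^+ 2)) * p.1
      - (q.1 - p.1) * (p.1 ^+ 2 + p.2 ^+ 2)) z.
Proof. rewrite /gdet /hline; ring. Qed.

(** The integral of dx / y along the geodesic from p to q. *)
Definition edge_angle {R : realType} (p q : R * R) : R :=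
  2 * atan ((q.1 - p.1) / (p.2 + q.2)).

Definition above {R : realType} (p q : R * R) : set (R * R) :=
  hplane `&` [set z | p.1 <= z.1 < q.1] `&` [set z | 0 <= gdet p q z].

Lemma measurable_strip (R : realType) (x1 x2 : R) :
  measurable [set z : R * R | x1 <= z.1 < x2].
Proof.
rewrite (_ : [set z | _] = `[x1, x2[%classic `*` [set: R]); last first.
  by apply/seteqP; split => z; rewrite /= in_itv/= => // -[].
exact: measurableX.
Qed.

Lemma measurable_gdet_ge0 (R : realType) (p q : R * R) :
  measurable [set z | 0 <= gdet p q z].
Proof.
rewrite (eq_set (fun z => congr1 (fun t => is_true (0 <= t)) (gdet_hline p q z))).
exact: measurable_hline_ge0.
Qed.

Lemma measurable_above (R : realType) (p q : R * R) : measurable (above p q).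
Proof.
apply: measurableI; last exact: measurable_gdet_ge0.
by apply: measurableI; [exact: measurable_hplane|exact: measurable_strip].
Qed.

(** A chord of the parabola's epigraph stays strictly above the parabola
    because x |-> x^2 is convex: this is the positivity of the squared height,
    and the vertical section of [above p q] is then a half-line. *)
Lemma above_section (R : realType) (p q : R * R) (x y : R) :
  hplane p -> hplane q -> p.1 <= x <= q.1 -> p.1 < q.1 ->
  let al := (q.1 ^+ 2 + q.2 ^+ 2 - (p.1 ^+ 2 + p.2 ^+ 2)) / (q.1 - p.1) in
  let be := p.1 ^+ 2 + p.2 ^+ 2 - al * p.1 in
  0 < al * x + be - x ^+ 2 /\
  ((0 < y /\ 0 <= gdet p q (x, y)) <-> Num.sqrt (al * x + be - x ^+ 2) <= y).
Proof.
move=> p0 q0 /andP[px xq] pq al be; rewrite /hplane /= in p0 q0.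
have d0 : 0 < q.1 - p.1 by rewrite subr_gt0.
have g0 : 0 < al * x + be - x ^+ 2.
  rewrite -(pmulr_rgt0 _ d0).
  have -> : (q.1 - p.1) * (al * x + be - x ^+ 2) =
    (q.1 - x) * p.2 ^+ 2 + (x - p.1) * q.2 ^+ 2 + (q.1 - p.1) * ((x - p.1) * (q.1 - x)).
    by rewrite /be /al; field; rewrite gt_eqF.
  have p2 : 0 < p.2 ^+ 2 by rewrite exprn_gt0.
  have q2 : 0 < q.2 ^+ 2 by rewrite exprn_gt0.
  have x1 : 0 <= (q.1 - p.1) * ((x - p.1) * (q.1 - x)).
    by apply: mulr_ge0; [exact: ltW|apply: mulr_ge0; rewrite subr_ge0].
  have [xp|xp] := eqVneq x p.1.
    by rewrite xp subrr !mul0r mulr0 !addr0 mulr_gt0.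
  have x2 : 0 < (x - p.1) * q.2 ^+ 2 by rewrite mulr_gt0// subr_gt0 lt_neqAle eq_sym xp.
  have x3 : 0 <= (q.1 - x) * p.2 ^+ 2 by rewrite mulr_ge0 ?subr_ge0// ltW.
  by rewrite ltr_wpDr// ltr_wpDl.
split => //.
have -> : gdet p q (x, y) = (q.1 - p.1) * (y ^+ 2 - (al * x + be - x ^+ 2)).
  by rewrite /gdet /be /al /=; field; rewrite gt_eqF.
rewrite pmulr_rge0// subr_ge0; split => [[y0 h]|h].
  by rewrite -(ger0_norm (ltW y0)) -sqrtr_sqr ler_sqrt ?sqr_ge0.
have y0 : 0 < y by apply: lt_le_trans h; rewrite sqrtr_gt0.
split => //; rewrite -[leLHS]sqr_sqrtr ?(ltW g0)//.
by apply: lerXn2r => //; rewrite nnegrE ?sqrtr_ge0// ltW.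
Qed.

Lemma measurable_density_patch (R : realType) (A : set (R * R)) :
  measurable A ->
  measurable_fun setT ((EFin \o (fun z : R * R => z.2 ^- 2)) \_ A).
Proof.
move=> mA; apply: (measurable_restrictT _ mA).1; exact: measurable_density.
Qed.

Lemma hvol_above (R : realType) (p q : R * R) : hplane p -> hplane q ->
  p.1 <= q.1 -> hvol (above p q) = (edge_angle p q)%:E.
Proof.
move=> p0 q0; rewrite le_eqVlt => /orP[/eqP pq|pq].
  rewrite /edge_angle pq subrr mul0r atan0 mulr0 /hvol.
  rewrite (_ : above p q = set0) ?integral_set0//.
  by apply/seteqP; split => // z [[_ /=]]; rewrite pq => /andP[a /(le_lt_trans a)]; rewrite ltxx.
rewrite /hvol integral_mkcond.
rewrite fubini_tonelli1; last 2 first.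
- exact: (measurable_density_patch (measurable_above p q)).
- by move=> z; rewrite patchE; case: ifP => // _; exact: density_ge0.
set al := (q.1 ^+ 2 + q.2 ^+ 2 - (p.1 ^+ 2 + p.2 ^+ 2)) / (q.1 - p.1).
set be := p.1 ^+ 2 + p.2 ^+ 2 - al * p.1.
pose h (t : R) := Num.sqrt (al * t + be - t ^+ 2).
transitivity (\int[lebesgue_measure]_(x in `[p.1, q.1[) ((h x)^-1)%:E)%E.
  rewrite [RHS]integral_mkcond; apply: eq_integral => x _.
  rewrite patchE; case: ifPn => [|/negP] xI; last first.
    rewrite /fubini_F; apply: integral0_eq => y _.
    rewrite patchE ifF//; apply/negP; rewrite inE => -[[_ /= h1] _]; apply: xI.
    by rewrite inE /= in_itv.
  move: xI; rewrite inE /= in_itv/= => /andP[px xq].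
  have xpq : p.1 <= x <= q.1 by rewrite px ltW.
  have [g0 sec] := @above_section R p q x 0 p0 q0 xpq pq.
  rewrite -integral_invsqr_above ?sqrtr_gt0// [RHS]integral_mkcond.
  apply: eq_integral => y _; rewrite !patchE.
  have [_ sy] := @above_section R p q x y p0 q0 xpq pq.
  congr (if _ then _ else _).
  apply/idP/idP; rewrite !inE /= in_itv/= andbT.
    by move=> [[y0 _] gy]; apply/sy.
  by move=> /sy[y0 gy]; split => //; split => //=; rewrite px.
have g0 x : p.1 <= x <= q.1 -> 0 < al * x + be - x ^+ 2.
  by move=> xpq; have [] := @above_section R p q x 0 p0 q0 xpq pq.
rewrite integral_itv_bndo_bndc; last first.
  apply/measurable_EFinP.
  apply: (@measurable_funS _ _ _ _ `[p.1, q.1]%classic) => //.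
    by apply: subset_itvl; rewrite bnd_simp.
  apply: subspace_continuous_measurable_fun => //.
  exact: continuous_inv_height.
rewrite integral_inv_height//.
have d0 : q.1 - p.1 != 0 by rewrite gt_eqF// subr_gt0.
have -> : al * p.1 + be - p.1 ^+ 2 = p.2 ^+ 2 by rewrite /be; ring.
have -> : al * q.1 + be - q.1 ^+ 2 = q.2 ^+ 2 by rewrite /be /al; field.
by rewrite !sqrtr_sqr !ger0_norm ?ltW.
Qed.

(** * Orientation determinants and null sets *)

Lemma gdetC (R : realType) (p q z : R * R) : gdet q p z = - gdet p q z.
Proof. rewrite /gdet; ring. Qed.

Lemma gdet_cycle (R : realType) (p q z : R * R) : gdet p q z = gdet q z p.
Proof. rewrite /gdet; ring. Qed.

Lemma gdet_sum (R : realType) (p0 p1 p2 z : R * R) :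
  gdet p1 p2 z + gdet p2 p0 z + gdet p0 p1 z = gdet p0 p1 p2.
Proof. rewrite /gdet; ring. Qed.

(** Together with [gdet_sum] and [gdet_barycentric]: the three determinants are
    unnormalised barycentric coordinates of z in the triangle p0 p1 p2. *)
Lemma gdet_balance (R : realType) (p0 p1 p2 z : R * R) :
  gdet p1 p2 z * (z.1 - p0.1) + gdet p2 p0 z * (z.1 - p1.1) +
  gdet p0 p1 z * (z.1 - p2.1) = 0.
Proof. rewrite /gdet; ring. Qed.

Lemma gdet_barycentric (R : realType) (p0 p1 p2 a b z : R * R) :
  gdet p0 p1 p2 * gdet a b z = gdet p1 p2 z * gdet a b p0 +
    gdet p2 p0 z * gdet a b p1 + gdet p0 p1 z * gdet a b p2.
Proof. rewrite /gdet; ring. Qed.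

Lemma edge_angleC (R : realType) (p q : R * R) :
  edge_angle q p = - edge_angle p q.
Proof.
by rewrite /edge_angle -mulrN -atanN -mulNr opprB [q.2 + _]addrC.
Qed.

Lemma hvol_ge0 (R : realType) (A : set (R * R)) : (0 <= hvol A)%E.
Proof. by apply: integral_ge0 => z _; exact: density_ge0. Qed.

Lemma hvol_subset0 (R : realType) (A N : set (R * R)) :
  measurable A -> measurable N -> A `<=` N -> hvol N = 0%E -> hvol A = 0%E.
Proof.
move=> mA mN AN N0; apply/eqP; rewrite eq_le hvol_ge0 andbT -N0.
apply: ge0_subset_integral => //; first exact: measurable_density.
by move=> *; exact: density_ge0.
Qed.

(** Boundary coincidences are discarded modulo a null set, so that the
    decompositions below only have to hold for points in general position. *)
Lemma hvol_ae_eq (R : realType) (A B N : set (R * R)) :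
  measurable A -> measurable B -> measurable N -> hvol N = 0%E ->
  A `\` N = B `\` N -> hvol A = hvol B.
Proof.
move=> mA mB mN N0 AB.
have split_off C : measurable C -> hvol C = hvol (C `\` N).
  move=> mC; rewrite -{1}(setUIDK C N) hvolU//.
  - rewrite (@hvol_subset0 _ _ N) ?add0e//; first exact: measurableI.
  - exact: measurableI.
  - exact: measurableD.
  - by rewrite setDE setIACA setIid setICr setI0.
by rewrite (split_off A)// (split_off B)// AB.
Qed.

Lemma hvolU_ae (R : realType) (A B N : set (R * R)) :
  measurable A -> measurable B -> measurable N -> hvol N = 0%E ->
  A `&` B `<=` N -> hvol (A `|` B) = (hvol A + hvol B)%E.
Proof.
move=> mA mB mN N0 AB.
have mBN : measurable (B `\` N) by exact: measurableD.
rewrite (@hvol_ae_eq _ (A `|` B) ((A `\` N) `|` (B `\` N)) N)//.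
- rewrite hvolU//.
  + congr (_ + _)%E; apply: (@hvol_ae_eq _ _ _ N) => //.
    * exact: measurableD.
    * by rewrite setDDl setUid.
    * by rewrite setDDl setUid.
  + exact: measurableD.
  + by apply/seteqP; split => // z [[Az Nz] [Bz _]]; apply: Nz; exact: AB.
- exact: measurableU.
- by apply: measurableU => //; exact: measurableD.
- by rewrite -setDUl setDDl setUid.
Qed.

Lemma hvolU_null (R : realType) (A B : set (R * R)) :
  measurable A -> measurable B -> hvol A = 0%E -> hvol B = 0%E ->
  hvol (A `|` B) = 0%E.
Proof.
move=> mA mB A0 B0.
by rewrite (@hvolU_ae _ A B A) ?A0 ?B0 ?adde0// => z [].
Qed.

Definition triangle {R : realType} (p q r : R * R) : set (R * R) :=
  hplane `&` [set z | [/\ 0 <= gdet p q z, 0 <= gdet q r z & 0 <= gdet r p z]].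

Lemma triangle_cycle (R : realType) (p q r : R * R) :
  triangle p q r = triangle q r p.
Proof. by apply/seteqP; split => z [? [? ? ?]]; split. Qed.

Lemma measurable_triangle (R : realType) (p q r : R * R) :
  measurable (triangle p q r).
Proof.
apply: measurableI; first exact: measurable_hplane.
rewrite (_ : [set z | _] = [set z | 0 <= gdet p q z] `&`
  [set z | 0 <= gdet q r z] `&` [set z | 0 <= gdet r p z]); last first.
  by apply/seteqP; split => z /=; [case|case; case].
by do 2 (apply: measurableI; last exact: measurable_gdet_ge0);
  exact: measurable_gdet_ge0.
Qed.

Definition vertical {R : realType} (x : R) : set (R * R) :=
  hplane `&` [set z | z.1 = x].

Definition chord {R : realType} (p q : R * R) : set (R * R) :=
  hplane `&` [set z | gdet p q z = 0].

Lemma verticalE (R : realType) (x : R) :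
  vertical x = hplane `&` [set z | hline 0 1 (- x) z = 0].
Proof.
by apply/seteqP; split => z [? /= h]; split => //=; move: h; rewrite /hline; lra.
Qed.

Lemma measurable_vertical (R : realType) (x : R) : measurable (vertical x).
Proof.
rewrite verticalE; apply: measurableI; first exact: measurable_hplane.
exact: measurable_hline_eq0.
Qed.

Lemma hvol_vertical (R : realType) (x : R) : hvol (vertical x) = 0%E.
Proof. by rewrite verticalE hvol_geodesic// oner_neq0 orbT. Qed.

Lemma chordE (R : realType) (p q : R * R) :
  chord p q = hplane `&` [set z | hline (q.1 - p.1)
    (- (q.1 ^+ 2 + q.2 ^+ 2 - (p.1 ^+ 2 + p.2 ^+ 2)))
    ((q.1 ^+ 2 + q.2 ^+ 2 - (p.1 ^+ 2 + p.2 ^+ 2)) * p.1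
      - (q.1 - p.1) * (p.1 ^+ 2 + p.2 ^+ 2)) z = 0].
Proof. by apply/seteqP; split => z [? /= h]; split => //=; move: h; rewrite gdet_hline. Qed.

Lemma measurable_chord (R : realType) (p q : R * R) : measurable (chord p q).
Proof.
rewrite chordE; apply: measurableI; first exact: measurable_hplane.
exact: measurable_hline_eq0.
Qed.

Lemma hvol_chord (R : realType) (p q r : R * R) :
  gdet p q r != 0 -> hvol (chord p q) = 0%E.
Proof.
move=> pqr; rewrite chordE hvol_geodesic//; apply: contraNT pqr.
rewrite negb_or !negbK oppr_eq0 => /andP[/eqP h1 /eqP h2].
by rewrite /gdet h1 h2 !mul0r subrr.
Qed.

(** Torque balance on a line: if v and w are nonnegative and pull to the right
    of x, the weight u at the left of x has to be nonnegative as well. *)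
Lemma balance_pos (R : realType) (u v w x0 x1 x2 x : R) :
  u * (x - x0) + v * (x - x1) + w * (x - x2) = 0 ->
  x0 < x -> x < x1 -> x < x2 -> 0 <= v -> 0 <= w -> 0 <= u.
Proof.
move=> b h0 h1 h2 v0 w0; rewrite -(pmulr_lge0 _ (_ : 0 < x - x0)) ?subr_gt0//.
have := mulr_ge0 v0 (ltW (_ : 0 < x1 - x)); rewrite subr_gt0 => /(_ h1).
have := mulr_ge0 w0 (ltW (_ : 0 < x2 - x)); rewrite subr_gt0 => /(_ h2).
lra.
Qed.

(** The abscissa of a point of the triangle is a convex combination of those of
    the vertices. *)
Lemma triangle_strip (R : realType) (p0 p1 p2 z : R * R) :
  0 < gdet p0 p1 p2 -> triangle p0 p1 p2 z ->
  forall a b, a <= p0.1 <= b -> a <= p1.1 <= b -> a <= p2.1 <= b -> a <= z.1 <= b.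
Proof.
move=> D0 [_ [w0 u0 v0]] a b /andP[a0 b0] /andP[a1 b1] /andP[a2 b2].
have s := gdet_sum p0 p1 p2 z; have bal := gdet_balance p0 p1 p2 z.
move: (gdet p1 p2 z) (gdet p2 p0 z) (gdet p0 p1 z) (gdet p0 p1 p2)
  D0 w0 u0 v0 s bal => u v w D D0 w0 u0 v0 s bal.
have ge0 (t e f : R) : 0 <= t -> e <= f -> 0 <= t * (f - e).
  by move=> ? ?; apply: mulr_ge0 => //; rewrite subr_ge0.
apply/andP; split.
- rewrite -subr_ge0 -(pmulr_rge0 _ D0).
  have := ge0 _ _ _ u0 a0; have := ge0 _ _ _ v0 a1; have := ge0 _ _ _ w0 a2.
  move: s bal; clear; move=> <-; lra.
- rewrite -subr_ge0 -(pmulr_rge0 _ D0).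
  have := ge0 _ _ _ u0 b0; have := ge0 _ _ _ v0 b1; have := ge0 _ _ _ w0 b2.
  move: s bal; clear; move=> <-; lra.
Qed.

(** * Area of triangles and quadrangles *)

Lemma eq_setD_off (T : Type) (A B N : set T) :
  (forall z, ~ N z -> A z -> B z) -> (forall z, ~ N z -> B z -> A z) ->
  A `\` N = B `\` N.
Proof.
by move=> AB BA; apply/seteqP; split => z [? Nz]; split=> //; [exact: AB|exact: BA].
Qed.

Lemma adde_EFin_eq (R : realType) (x : \bar R) (a b : R) :
  (x + a%:E)%E = b%:E -> x = (b - a)%:E.
Proof. by move=> h; rewrite EFinB -h addeK. Qed.

Definition verticals {R : realType} (p0 p1 p2 : R * R) : set (R * R) :=
  vertical p0.1 `|` vertical p1.1 `|` vertical p2.1.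

Lemma measurable_verticals (R : realType) (p0 p1 p2 : R * R) :
  measurable (verticals p0 p1 p2).
Proof. by repeat apply: measurableU; exact: measurable_vertical. Qed.

Lemma hvol_verticals (R : realType) (p0 p1 p2 : R * R) :
  hvol (verticals p0 p1 p2) = 0%E.
Proof.
have m := @measurable_vertical R; have h := @hvol_vertical R.
by apply: hvolU_null => //; [exact: measurableU|exact: hvolU_null].
Qed.

Lemma off_verticals (R : realType) (p0 p1 p2 z : R * R) :
  hplane z -> ~ verticals p0 p1 p2 z ->
  [/\ z.1 != p0.1, z.1 != p1.1 & z.1 != p2.1].
Proof.
by move=> z0 N; split; apply/eqP => e; apply: N; [left; left|left; right|right].
Qed.

Lemma aboveP (R : realType) (p q z : R * R) : above p q z <->
  [/\ hplane z, p.1 <= z.1, z.1 < q.1 & 0 <= gdet p q z].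
Proof.
split; first by move=> [[z0 s] g]; move/andP: s => [].
by move=> [z0 a b g]; split => //; split => //=; rewrite a.
Qed.

(** Mirror image of [balance_pos]. *)
Lemma balance_posN (R : realType) (u v w x0 x1 x2 x : R) :
  u * (x - x0) + v * (x - x1) + w * (x - x2) = 0 ->
  x < x0 -> x1 < x -> x2 < x -> 0 <= v -> 0 <= w -> 0 <= u.
Proof.
move=> b h0 h1 h2; apply: (@balance_pos R u v w (- x0) (- x1) (- x2) (- x));
  rewrite ?ltrN2//; lra.
Qed.

(** If w were negative, the weight u would have to be positive as the total is,
    and all three torques about x would be nonnegative, two of them positive. *)
Lemma balance_neg (R : realType) (u v w x0 x1 x2 x : R) :
  u * (x - x0) + v * (x - x1) + w * (x - x2) = 0 -> 0 < u + v + w ->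
  x0 < x -> x < x1 -> x < x2 -> v <= 0 -> 0 <= w.
Proof.
move=> b D0 h0 h1 h2 v0; rewrite leNgt; apply/negP => w0.
have u0 : 0 < u by lra.
have : 0 < u * (x - x0) by rewrite mulr_gt0// subr_gt0.
have : 0 <= v * (x - x1) by rewrite mulr_le0// subr_le0 ltW.
have : 0 < w * (x - x2) by rewrite nmulr_lgt0// subr_lt0.
lra.
Qed.

(** Mirror image of [balance_neg]. *)
Lemma balance_negN (R : realType) (u v w x0 x1 x2 x : R) :
  u * (x - x0) + v * (x - x1) + w * (x - x2) = 0 -> 0 < u + v + w ->
  x < x0 -> x1 < x -> x2 < x -> v <= 0 -> 0 <= w.
Proof.
move=> b D0 h0 h1 h2; apply: (@balance_neg R u v w (- x0) (- x1) (- x2) (- x));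
  rewrite ?ltrN2//; lra.
Qed.

(** When the vertex p1, in the middle, lies below the chord p0 p2, the region
    above the broken line p0 p1 p2 is the union of the triangle and of the
    region above the chord p0 p2. *)
Lemma hvol_triangle_below (R : realType) (p0 p1 p2 : R * R) :
  hplane p0 -> hplane p1 -> hplane p2 -> 0 < gdet p0 p1 p2 ->
  p0.1 <= p1.1 <= p2.1 ->
  hvol (triangle p0 p1 p2) =
    (edge_angle p0 p1 + edge_angle p1 p2 + edge_angle p2 p0)%:E.
Proof.
move=> y0 y1 y2 D0 /andP[x01 x12]; have x02 := le_trans x01 x12.
rewrite (edge_angleC p0 p2); apply: adde_EFin_eq.
rewrite EFinD -!hvol_above//.
have m a b : measurable (@above R a b) by exact: measurable_above.
have mT := measurable_triangle p0 p1 p2.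
rewrite -[RHS]hvolU//; last first.
  apply/seteqP; split => // z [/aboveP[_ _ a _] /aboveP[_ b _ _]].
  by have := le_lt_trans b a; rewrite ltxx.
rewrite -(hvolU_ae _ _ (measurable_chord p0 p2))//; first last.
- move=> z [[z0 [_ _ /= h1]] /aboveP[_ _ _ /= h2]]; split => //=.
  by apply/eqP; rewrite eq_le h2 andbT; move: h1; rewrite gdetC oppr_ge0.
- by rewrite (@hvol_chord _ _ _ p1)// -gdet_cycle gdetC oppr_eq0 gt_eqF.
apply: (hvol_ae_eq _ _ (measurable_verticals p0 p1 p2));
  [exact: measurableU|exact: measurableU|exact: hvol_verticals|].
apply: eq_setD_off => z Nz.
- move=> [Tz|/aboveP[z0 xz zx gz]].
    have /andP[a b] := triangle_strip D0 Tz (a := p0.1) (b := p2.1)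
      ltac:(by rewrite lexx x02) ltac:(by rewrite x01) ltac:(by rewrite x02 lexx).
    case: Tz => z0 [h0 h1 h2].
    have [n0 n1 n2] := off_verticals z0 Nz.
    have [c|c] := ltP z.1 p1.1; [left|right]; apply/aboveP; split => //.
    by rewrite lt_neqAle n2.
  have [n0 n1 n2] := off_verticals z0 Nz.
  have lx : p0.1 < z.1 by rewrite lt_neqAle eq_sym n0.
  move: gz; rewrite gdetC oppr_ge0 => v0.
  have s := gdet_sum p0 p1 p2 z; have bal := gdet_balance p0 p1 p2 z.
  rewrite -s in D0.
  have [c|c] := ltP z.1 p1.1; [left|right]; apply/aboveP; split => //.
    by apply: (balance_neg bal) => //; lra.
  have lx1 : p1.1 < z.1 by rewrite lt_neqAle eq_sym n1.
  apply: (@balance_negN _ (gdet p0 p1 z) (gdet p2 p0 z) _ p2.1 p1.1 p0.1 z.1) => //; lra.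
- have bal := gdet_balance p0 p1 p2 z.
  move=> [|] /aboveP[z0 xz zx gz]; have [n0 n1 n2] := off_verticals z0 Nz.
    have lx : p0.1 < z.1 by rewrite lt_neqAle eq_sym n0.
    have zx2 : z.1 < p2.1 by exact: lt_le_trans x12.
    have [v0|v0] := leP 0 (gdet p2 p0 z); [left|right].
      by split => //; split => //=; exact: (balance_pos bal).
    by apply/aboveP; split => //; rewrite gdetC oppr_ge0 ltW.
  have lx : p1.1 < z.1 by rewrite lt_neqAle eq_sym n1.
  have lx0 : p0.1 < z.1 by exact: le_lt_trans lx.
  have [v0|v0] := leP 0 (gdet p2 p0 z); [left|right].
    split => //; split => //=.
    by apply: (@balance_posN _ _ (gdet p1 p2 z) (gdet p2 p0 z) p2.1 p0.1 p1.1 z.1) => //; lra.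
  by apply/aboveP; split => //; [exact: ltW|rewrite gdetC oppr_ge0 ltW].
Qed.

(** When the vertex p2, in the middle, lies above the chord p0 p1, the region
    above that chord is the union of the triangle and of the two regions above
    the chords p0 p2 and p2 p1. *)
Lemma hvol_triangle_above (R : realType) (p0 p1 p2 : R * R) :
  hplane p0 -> hplane p1 -> hplane p2 -> 0 < gdet p0 p1 p2 ->
  p0.1 <= p2.1 <= p1.1 ->
  hvol (triangle p0 p1 p2) =
    (edge_angle p0 p1 + edge_angle p1 p2 + edge_angle p2 p0)%:E.
Proof.
move=> y0 y1 y2 D0 /andP[x02 x21]; have x01 := le_trans x02 x21.
have -> : edge_angle p0 p1 + edge_angle p1 p2 + edge_angle p2 p0 =
  edge_angle p0 p1 - (edge_angle p0 p2 + edge_angle p2 p1).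
  by rewrite (edge_angleC p2 p1) (edge_angleC p0 p2) opprD -addrA [- _ - _ in RHS]addrC.
apply: adde_EFin_eq; rewrite EFinD -!hvol_above//.
have m a b : measurable (@above R a b) by exact: measurable_above.
have mT := measurable_triangle p0 p1 p2.
rewrite -(@hvolU _ (above p0 p2) (above p2 p1))//; last first.
  apply/seteqP; split => // z [/aboveP[_ _ a _] /aboveP[_ b _ _]].
  by have := le_lt_trans b a; rewrite ltxx.
rewrite -(@hvolU_ae _ _ _ (chord p0 p2 `|` chord p2 p1))//; first last.
- move=> z [[z0 [_ /= h1 h2]] [|] /aboveP[_ _ _ h]]; [left|right]; split => //=; apply/eqP;
    rewrite eq_le h andbT; [move: h2|move: h1]; by rewrite gdetC oppr_ge0.
- apply: hvolU_null; try exact: measurable_chord.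
    by rewrite (@hvol_chord _ _ _ p1)// -gdet_cycle gdetC oppr_eq0 gt_eqF.
  by rewrite (@hvol_chord _ _ _ p0)// gdetC oppr_eq0 -gdet_cycle gt_eqF.
- by apply: measurableU; exact: measurable_chord.
- exact: measurableU.
apply: (hvol_ae_eq _ _ (measurable_verticals p0 p1 p2)) => //;
  [by do 2 apply: measurableU => //|exact: hvol_verticals|].
apply: eq_setD_off => z Nz.
- move=> [Tz|[|]].
  + have /andP[a b] := triangle_strip D0 Tz (a := p0.1) (b := p1.1)
      ltac:(by rewrite lexx x01) ltac:(by rewrite x01 lexx) ltac:(by rewrite x02).
    case: Tz => z0 [h0 h1 h2].
    have [n0 n1 n2] := off_verticals z0 Nz.
    by apply/aboveP; split => //; rewrite lt_neqAle n1.
  + move=> /aboveP[z0 xz zx]; rewrite gdetC oppr_ge0 => v0.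
    have [n0 n1 n2] := off_verticals z0 Nz.
    have lx : p0.1 < z.1 by rewrite lt_neqAle eq_sym n0.
    have zx1 : z.1 < p1.1 by exact: lt_le_trans x21.
    apply/aboveP; split => //.
    apply: (balance_neg (gdet_balance p0 p1 p2 z)) => //.
    by rewrite gdet_sum.
  + move=> /aboveP[z0 xz zx]; rewrite gdetC oppr_ge0 => u0.
    have [n0 n1 n2] := off_verticals z0 Nz.
    have lx : p2.1 < z.1 by rewrite lt_neqAle eq_sym n2.
    have lx0 : p0.1 < z.1 by exact: le_lt_trans lx.
    have s := gdet_sum p0 p1 p2 z; have bal := gdet_balance p0 p1 p2 z.
    rewrite -s in D0.
    apply/aboveP; split => //; first exact: ltW.
    by apply: (@balance_negN _ (gdet p2 p0 z) (gdet p1 p2 z) _ p1.1 p0.1 p2.1 z.1) => //; lra.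
- have bal := gdet_balance p0 p1 p2 z.
  move=> /aboveP[z0 xz zx w0].
  have [n0 n1 n2] := off_verticals z0 Nz.
  have lx : p0.1 < z.1 by rewrite lt_neqAle eq_sym n0.
  have [c|c] := ltP z.1 p2.1.
    have [v0|v0] := leP 0 (gdet p2 p0 z); [left|right; left].
      by split => //; split => //=; exact: (balance_pos bal).
    by apply/aboveP; split => //; rewrite gdetC oppr_ge0 ltW.
  have lx2 : p2.1 < z.1 by rewrite lt_neqAle eq_sym n2.
  have [u0|u0] := leP 0 (gdet p1 p2 z); [left|right; right].
    split => //; split => //=.
    by apply: (@balance_posN _ _ (gdet p1 p2 z) (gdet p0 p1 z) p1.1 p0.1 p2.1 z.1) => //; lra.
  by apply/aboveP; split => //; rewrite gdetC oppr_ge0 ltW.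
Qed.

(** Both sides are invariant under cyclic permutation, so the leftmost vertex
    may be put first; the position of the middle one then decides between the
    two previous lemmas. *)
Lemma hvol_triangle (R : realType) (p0 p1 p2 : R * R) :
  hplane p0 -> hplane p1 -> hplane p2 -> 0 < gdet p0 p1 p2 ->
  hvol (triangle p0 p1 p2) =
    (edge_angle p0 p1 + edge_angle p1 p2 + edge_angle p2 p0)%:E.
Proof.
have leftmost (a b c : R * R) : hplane a -> hplane b -> hplane c ->
    0 < gdet a b c -> a.1 <= b.1 -> a.1 <= c.1 -> hvol (triangle a b c) =
    (edge_angle a b + edge_angle b c + edge_angle c a)%:E.
  move=> a0 b0 c0 D0 ab ac; have [bc|cb] := leP b.1 c.1.
    by apply: hvol_triangle_below => //; rewrite ab.
  by apply: hvol_triangle_above => //; rewrite ac ltW.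
move=> y0 y1 y2 D0.
have D1 : 0 < gdet p1 p2 p0 by rewrite -gdet_cycle.
have D2 : 0 < gdet p2 p0 p1 by rewrite gdet_cycle.
have [x01|x10] := leP p0.1 p1.1; have [x02|x20] := leP p0.1 p2.1.
- exact: leftmost.
- have x21 := lt_le_trans x20 x01.
  by rewrite -triangle_cycle leftmost ?(ltW x20) ?(ltW x21)//; congr EFin; lra.
- have x12 := lt_le_trans x10 x02.
  by rewrite triangle_cycle leftmost ?(ltW x10) ?(ltW x12)//; congr EFin; lra.
- have [x12|x21] := leP p1.1 p2.1.
    by rewrite triangle_cycle leftmost ?(ltW x10)//; congr EFin; lra.
  by rewrite -triangle_cycle leftmost ?(ltW x20) ?(ltW x21)//; congr EFin; lra.
Qed.

Definition quadrangle {R : realType} (p0 p1 p2 p3 : R * R) : set (R * R) :=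
  hplane `&` [set z | [/\ 0 <= gdet p0 p1 z, 0 <= gdet p1 p2 z,
                          0 <= gdet p2 p3 z & 0 <= gdet p3 p0 z]].

(** The diagonal p0 p2 cuts the quadrangle. The inclusion of the two triangles
    is convexity: a half-plane that contains the vertices contains the
    barycentric combinations. *)
Lemma quadrangle_split (R : realType) (p0 p1 p2 p3 : R * R) :
  0 < gdet p0 p1 p2 -> 0 < gdet p1 p2 p3 -> 0 < gdet p2 p3 p0 ->
  0 < gdet p3 p0 p1 ->
  quadrangle p0 p1 p2 p3 = triangle p0 p1 p2 `|` triangle p0 p2 p3.
Proof.
move=> D0 D1 D2 D3; apply/seteqP; split => z.
  move=> [z0 [h0 h1 h2 h3]]; have [g|g] := leP 0 (gdet p0 p2 z).
    by right; split.
  by left; split => //; split => //; rewrite gdetC oppr_ge0 ltW.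
have comb (p q r a b : R * R) : 0 < gdet p q r -> 0 <= gdet a b p ->
    0 <= gdet a b q -> 0 <= gdet a b r -> triangle p q r z -> 0 <= gdet a b z.
  move=> D hp hq hr [_ [w0 u0 v0]].
  by rewrite -(pmulr_rge0 _ D) gdet_barycentric !addr_ge0// mulr_ge0.
have gd0 (a b : R * R) : gdet a b a = 0 by rewrite /gdet; ring.
have gd1 (a b : R * R) : gdet a b b = 0 by rewrite /gdet; ring.
have D2' : 0 < gdet p0 p2 p3 by rewrite gdet_cycle.
have [E0 E1 E2 E3] : [/\ 0 < gdet p1 p2 p0, 0 < gdet p2 p3 p1,
    0 < gdet p3 p0 p2 & 0 < gdet p0 p1 p3] by split; rewrite -gdet_cycle.
move=> [Tz|Tz]; have [z0 [h0 h1 h2]] := Tz; split => //; split => //;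
  by apply: comb Tz; rewrite ?gd0 ?gd1// ltW.
Qed.

(** The contributions of the diagonal to the two triangles cancel. *)
Lemma hvol_quadrangle (R : realType) (p0 p1 p2 p3 : R * R) :
  hplane p0 -> hplane p1 -> hplane p2 -> hplane p3 ->
  0 < gdet p0 p1 p2 -> 0 < gdet p1 p2 p3 -> 0 < gdet p2 p3 p0 ->
  0 < gdet p3 p0 p1 ->
  hvol (quadrangle p0 p1 p2 p3) =
    (edge_angle p0 p1 + edge_angle p1 p2 + edge_angle p2 p3 + edge_angle p3 p0)%:E.
Proof.
move=> y0 y1 y2 y3 D0 D1 D2 D3; rewrite quadrangle_split//.
have D2' : 0 < gdet p0 p2 p3 by rewrite gdet_cycle.
rewrite (hvolU_ae _ _ (measurable_chord p0 p2)).
- rewrite !hvol_triangle// -EFinD; congr EFin.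
  by rewrite (edge_angleC p0 p2); lra.
- exact: measurable_triangle.
- exact: measurable_triangle.
- by rewrite (@hvol_chord _ _ _ p3)// gt_eqF.
- move=> z [[z0 [_ _ /= h1]] [_ [/= h2 _ _]]]; split => //=.
  by apply/eqP; rewrite eq_le h2 andbT; move: h1; rewrite gdetC oppr_ge0.
Qed.

(** * Convex quadrilaterals as intersections of determinant half-planes *)

(** Plucker relation: four vectors (x^2 + y^2, x, 1) in a space of dimension 3
    are dependent, and hline is linear in such a vector. Hence a line function
    that vanishes at p and q is proportional to gdet p q. *)
Lemma hline_gdet (R : realType) (a b c : R) (p q z w : R * R) :
  hline a b c p = 0 -> hline a b c q = 0 ->
  hline a b c w * gdet p q z = hline a b c z * gdet p q w.
Proof.
move=> hp hq.
have : hline a b c p * gdet q z w - hline a b c q * gdet p z w +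
  hline a b c z * gdet p q w - hline a b c w * gdet p q z = 0.
  by rewrite /hline /gdet; ring.
by rewrite hp hq !mul0r subrr add0r => /eqP; rewrite subr_eq0 => /eqP.
Qed.

Lemma gdet_nondegenerate (R : realType) (p q : R * R) :
  hplane p -> hplane q -> p <> q -> exists z, gdet p q z != 0.
Proof.
case: p => x y; case: q => x' y'; rewrite /hplane/= => y0 y0' pq.
have [xx|xx] := eqVneq x x'.
- exists (x + 1, y); rewrite /gdet /= -xx subrr mul0r sub0r oppr_eq0.
  have -> : (x ^+ 2 + y' ^+ 2 - (x ^+ 2 + y ^+ 2)) * (x + 1 - x) = y' ^+ 2 - y ^+ 2.
    by ring.
  rewrite subr_eq0 eqf_sqr negb_or.
  apply/andP; split; first by apply/eqP => yy; apply: pq; rewrite xx yy.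
  by rewrite gt_eqF// (lt_trans _ y0')// oppr_lt0.
- exists (x, y + 1); rewrite /gdet /= subrr mulr0 subr0 mulf_neq0//.
    by rewrite subr_eq0 eq_sym.
  have -> : x ^+ 2 + (y + 1) ^+ 2 - (x ^+ 2 + y ^+ 2) = 2 * y + 1 by ring.
  by rewrite gt_eqF// addr_gt0// mulr_gt0.
Qed.

Lemma hp_funE (R : realType) (h : halfplane R) :
  hp_fun h = hline (hp_a h) (hp_b h) (hp_c h).
Proof. by []. Qed.

Lemma closed_halfplane_gdet (R : realType) (h : halfplane R) (p q w : R * R) :
  geodesic h p -> geodesic h q -> p <> q -> open_halfplane h w ->
  gdet p q w != 0 /\
  closed_halfplane h =
    hplane `&` [set z | 0 <= gdet p q w * gdet p q z].
Proof.
move=> [p0 /= hp] [q0 /= hq] pq [w0 /= hw]; rewrite hp_funE in hp hq hw.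
have pl z := hline_gdet z w hp hq.
have g0 : gdet p q w != 0.
  have [z gz] := gdet_nondegenerate p0 q0 pq.
  apply: contraNneq gz => g0; move: (pl z); rewrite g0 mulr0 => /eqP.
  by rewrite mulf_eq0 gt_eqF.
split => //; apply/seteqP; split => z [z0 /= hz]; split => //=.
- rewrite -(pmulr_rge0 _ hw) mulrCA pl mulrCA mulr_ge0//.
  by rewrite -expr2 sqr_ge0.
- move: hz; rewrite -(pmulr_rge0 _ hw) mulrCA pl mulrCA -expr2 pmulr_lge0//.
  by rewrite lt_neqAle sqr_ge0 eq_sym expf_neq0.
Qed.

Lemma open_halfplane_gdet (R : realType) (h : halfplane R) (p q w z : R * R) :
  geodesic h p -> geodesic h q -> p <> q -> open_halfplane h w ->
  open_halfplane h z -> 0 < gdet p q w * gdet p q z.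
Proof.
move=> hp hq pq hw hz.
have [gz _] := closed_halfplane_gdet hp hq pq hz.
have [gw ch] := closed_halfplane_gdet hp hq pq hw.
have : closed_halfplane h z by case: hz => ? /= /ltW.
rewrite ch => -[_ /=]; rewrite le_eqVlt => /orP[|//].
by rewrite eq_sym mulf_eq0 (negPf gz) (negPf gw).
Qed.

Lemma forall_I4 (P : 'I_4 -> Prop) : P 0 -> P 1 -> P 2 -> P 3 -> forall i, P i.
Proof.
move=> P0 P1 P2 P3 [[|[|[|[|//]]]] Hi].
- by rewrite (_ : Ordinal Hi = 0)//; apply/val_inj.
- by rewrite (_ : Ordinal Hi = 1)//; apply/val_inj.
- by rewrite (_ : Ordinal Hi = 2)//; apply/val_inj.
- by rewrite (_ : Ordinal Hi = 3)//; apply/val_inj.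
Qed.

Lemma ordS_I4 : [/\ ordS (0 : 'I_4) = 1, ordS (1 : 'I_4) = 2,
  ordS (2 : 'I_4) = 3 & ordS (3 : 'I_4) = 0].
Proof. by split; apply/val_inj. Qed.

Definition ccw_quadrangle {R : realType} (p0 p1 p2 p3 : R * R) : Prop :=
  [/\ 0 < gdet p0 p1 p2, 0 < gdet p1 p2 p3, 0 < gdet p2 p3 p0 & 0 < gdet p3 p0 p1].

(** Each of the four convexity conditions compares the signs of two consecutive
    orientation determinants, so all four determinants have the same sign; this
    sign tells in which direction the vertices run around the quadrangle. *)
Lemma convex_quadrangle (R : realType) (Q : set (R * R)) (P : 'I_4 -> R * R) :
  convex_polygon Q P ->
  (forall i, hplane (P i)) /\
  ((ccw_quadrangle (P 0) (P 1) (P 2) (P 3) /\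
    Q = quadrangle (P 0) (P 1) (P 2) (P 3)) \/
   (ccw_quadrangle (P 3) (P 2) (P 1) (P 0) /\
    Q = quadrangle (P 3) (P 2) (P 1) (P 0))).
Proof.
move=> [_ [h [on1 on2 off Qh]]].
have y i : hplane (P i) by have [] := on1 i.
split => //.
have [S0 S1 S2 S3] := ordS_I4.
have := on2 0; have := on2 1; have := on2 2; have := on2 3.
rewrite S0 S1 S2 S3 => g3 g2 g1 g0.
have o0 := off 0; rewrite S0 in o0.
have o1 := off 1; rewrite S1 in o1.
have o2 := off 2; rewrite S2 in o2.
have o3 := off 3; rewrite S3 in o3.
have off_ne i p q : geodesic (h i) p -> open_halfplane (h i) q -> p <> q.
  by move=> [_ /= a] [_ /= b] pq; move: b; rewrite -pq a ltxx.
have n01 : P 0 <> P 1 by apply/nesym/(off_ne 1); [exact: on1|exact: o1].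
have n12 : P 1 <> P 2 by apply/nesym/(off_ne 2); [exact: on1|exact: o2].
have n23 : P 2 <> P 3 by apply/nesym/(off_ne 3); [exact: on1|exact: o3].
have n30 : P 3 <> P 0 by apply/nesym/(off_ne 0); [exact: on1|exact: o0].
have [d0 c0] := closed_halfplane_gdet (on1 0) g0 n01 (o0 2 isT isT).
have [d1 c1] := closed_halfplane_gdet (on1 1) g1 n12 (o1 3 isT isT).
have [d2 c2] := closed_halfplane_gdet (on1 2) g2 n23 (o2 0 isT isT).
have [d3 c3] := closed_halfplane_gdet (on1 3) g3 n30 (o3 1 isT isT).
have := open_halfplane_gdet (on1 0) g0 n01 (o0 2 isT isT) (o0 3 isT isT).
have := open_halfplane_gdet (on1 1) g1 n12 (o1 3 isT isT) (o1 0 isT isT).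
have := open_halfplane_gdet (on1 2) g2 n23 (o2 0 isT isT) (o2 1 isT isT).
have r01 : gdet (P 0) (P 1) (P 3) = gdet (P 3) (P 0) (P 1) by rewrite -gdet_cycle.
have r12 : gdet (P 1) (P 2) (P 0) = gdet (P 0) (P 1) (P 2) by rewrite -gdet_cycle.
have r23 : gdet (P 2) (P 3) (P 1) = gdet (P 1) (P 2) (P 3) by rewrite -gdet_cycle.
rewrite r01 r12 r23 => s21 s10 s03.
have QE z : Q z <-> [/\ closed_halfplane (h 0) z, closed_halfplane (h 1) z,
    closed_halfplane (h 2) z & closed_halfplane (h 3) z].
  rewrite Qh; split=> [hz|[z0 z1 z2 z3] i _]; first by split; exact: hz.
  by move: i; apply: forall_I4.
rewrite c0 c1 c2 c3 in QE.
have [e0|e0] := ltP 0 (gdet (P 0) (P 1) (P 2)).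
- have e1 : 0 < gdet (P 1) (P 2) (P 3) by rewrite pmulr_lgt0 in s10.
  have e2 : 0 < gdet (P 2) (P 3) (P 0) by rewrite pmulr_lgt0 in s21.
  have e3 : 0 < gdet (P 3) (P 0) (P 1) by rewrite pmulr_rgt0 in s03.
  left; split => //; apply/seteqP; split => z.
    move=> /QE[] /=; rewrite !pmulr_rge0// => -[z0 h0] [_ h1] [_ h2] [_ h3].
    by split.
  by move=> [z0 [h0 h1 h2 h3]]; apply/QE; split; split => //=; rewrite pmulr_rge0.
- have {}e0 : gdet (P 0) (P 1) (P 2) < 0 by rewrite lt_neqAle d0.
  have e1 : gdet (P 1) (P 2) (P 3) < 0 by rewrite nmulr_lgt0 in s10.
  have e2 : gdet (P 2) (P 3) (P 0) < 0 by rewrite nmulr_lgt0 in s21.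
  have e3 : gdet (P 3) (P 0) (P 1) < 0 by rewrite nmulr_rgt0 in s03.
  right; split.
    by split; rewrite gdetC oppr_gt0 ?r01 ?r12 ?r23// -gdet_cycle.
  apply/seteqP; split => z.
    move=> /QE[] /=; rewrite !nmulr_rge0// => -[z0 h0] [_ h1] [_ h2] [_ h3].
    by split => //; split; rewrite gdetC oppr_ge0.
  move=> [z0 [h0 h1 h2 h3]]; apply/QE; split; split => //=;
    by rewrite nmulr_rge0// -oppr_ge0 -gdetC.
Qed.

(** * Distance to a geodesic, and cycles as Euclidean circles *)

(** The number u - sqrt (u^2 - 1) is the inverse of u + sqrt (u^2 - 1). *)
Lemma cosh_arcosh (R : realType) (u : R) : 1 <= u -> cosh (arcosh u) = u.
Proof.
move=> u1; have u0 : 0 < u by exact: lt_le_trans u1.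
have s0 := sqrtr_ge0 (u ^+ 2 - 1).
have us : 0 < u + Num.sqrt (u ^+ 2 - 1) by exact: ltr_wpDr.
rewrite /cosh /arcosh expRN lnK ?posrE//.
have -> : (u + Num.sqrt (u ^+ 2 - 1))^-1 = u - Num.sqrt (u ^+ 2 - 1).
  apply: (mulfI (lt0r_neq0 us)); rewrite divff ?gt_eqF//.
  rewrite mulrC -subr_sqr sqr_sqrtr; first by ring.
  by rewrite subr_ge0 expr_ge1// ltW.
by field.
Qed.

Lemma arcosh_ge0 (R : realType) (u : R) : 1 <= u -> 0 <= arcosh u.
Proof. by move=> u1; apply: ln_ge0; rewrite ler_wpDr// sqrtr_ge0. Qed.

Lemma le_arcosh (R : realType) (u v : R) : 1 <= u -> u <= v -> arcosh u <= arcosh v.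
Proof.
move=> u1 uv; have u0 : 0 < u by exact: lt_le_trans u1.
have v0 : 0 < v by exact: lt_le_trans uv.
rewrite /arcosh ler_ln ?posrE; last 2 first.
- by rewrite ltr_wpDr// sqrtr_ge0.
- by rewrite ltr_wpDr// sqrtr_ge0.
by rewrite lerD// ler_wsqrtr// lerB// lerXn2r// nnegrE ltW.
Qed.

Definition cosh_dist {R : realType} (z w : R * R) : R :=
  1 + ((z.1 - w.1) ^+ 2 + (z.2 - w.2) ^+ 2) / (2 * z.2 * w.2).

Lemma cosh_dist_ge1 (R : realType) (z w : R * R) :
  hplane z -> hplane w -> 1 <= cosh_dist z w.
Proof.
rewrite /hplane/= => z0 w0; rewrite lerDl divr_ge0 ?addr_ge0 ?sqr_ge0//.
by rewrite !mulr_ge0// ltW.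
Qed.

Lemma cosh_hdist (R : realType) (z w : R * R) :
  hplane z -> hplane w -> cosh (hdist z w) = cosh_dist z w.
Proof. by move=> z0 w0; apply: cosh_arcosh; exact: cosh_dist_ge1. Qed.

(** Points of the plane are unit vectors of a Lorentzian form whose pairing is
    the cosh of the distance; al, be, ga are the entries, after the translation
    that brings w over 0, of the orthogonal projection of z to the hyperplane of
    the geodesic. The squared norm of this projection is al ga - be^2, the left
    side, and the claim is the reversed Cauchy-Schwarz inequality. *)
Lemma dist_geodesic_ge (R : realType) (h : halfplane R) (z w : R * R) :
  hplane z -> geodesic h w ->
  1 + hp_fun h z ^+ 2 / ((hp_b h ^+ 2 - 4 * hp_a h * hp_c h) * z.2 ^+ 2)
    <= cosh_dist z w ^+ 2.
Proof.
case: h z w => a b c disc [x y] [x' y'].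
rewrite /geodesic /hplane /hp_fun /cosh_dist /= => y0 [/= y'0 hw].
have ec : c = - (a * (x' ^+ 2 + y' ^+ 2) + b * x') by lra.
subst c; clear hw.
set D := b ^+ 2 - _ in disc *.
set F := (X in X ^+ 2 / _).
pose al := y^-1 + 2 * a * (F / y) / D.
pose be := (x - x') / y - (F / y) * (b + 2 * a * x') / D.
pose ga := ((x - x') ^+ 2 + y ^+ 2) / y - 2 * a * (F / y) * y' ^+ 2 / D.
have n1 : y != 0 by rewrite gt_eqF.
have n2 : y' != 0 by rewrite gt_eqF.
have n3 : D != 0 by rewrite gt_eqF.
have -> : 1 + ((x - x') ^+ 2 + (y - y') ^+ 2) / (2 * y * y') = (ga / y' + y' * al) / 2.
  by rewrite /ga /al; field; rewrite n1 n2 n3.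
have -> : 1 + F ^+ 2 / (D * y ^+ 2) = al * ga - be ^+ 2.
  have eD : (b + 2 * a * x') ^+ 2 + 4 * a ^+ 2 * y' ^+ 2 = D by rewrite /D; ring.
  have eF : F = a * ((x - x') ^+ 2 + y ^+ 2 - y' ^+ 2) + (b + 2 * a * x') * (x - x').
    by rewrite /F; ring.
  have -> : al * ga - be ^+ 2 = (D ^+ 2 * y ^+ 2 + 2 * F * D * (a * ((x - x') ^+ 2 + y ^+ 2 - y' ^+ 2) + (b + 2 * a * x') * (x - x'))
    - F ^+ 2 * ((b + 2 * a * x') ^+ 2 + 4 * a ^+ 2 * y' ^+ 2)) / (D ^+ 2 * y ^+ 2).
    by rewrite /al /be /ga; field; rewrite n1 n3.
  by rewrite -eF eD; field; rewrite n1 n3.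
have : 0 <= ((ga / y' - y' * al) / 2) ^+ 2 + be ^+ 2 by rewrite addr_ge0 ?sqr_ge0.
have -> : ((ga / y' + y' * al) / 2) ^+ 2 = ((ga / y' - y' * al) / 2) ^+ 2 + al * ga.
  by field.
lra.
Qed.

(** The witness is the foot of the perpendicular: the Lorentz-orthogonal
    projection of z to the hyperplane of the geodesic, normalised. *)
Lemma dist_geodesic_attained (R : realType) (h : halfplane R) (z : R * R) :
  hplane z -> exists2 w, geodesic h w &
  cosh_dist z w ^+ 2 =
  1 + hp_fun h z ^+ 2 / ((hp_b h ^+ 2 - 4 * hp_a h * hp_c h) * z.2 ^+ 2).
Proof.
case: h z => a b c disc [x y].
rewrite /geodesic /hplane /hp_fun /cosh_dist /= => y0.
set D := b ^+ 2 - _ in disc *.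
set F := (X in X ^+ 2 / _).
set k := 1 + _.
have n1 : y != 0 by rewrite gt_eqF.
have n3 : D != 0 by rewrite gt_eqF.
have k0 : 0 < k.
  by rewrite ltr_pwDl// divr_ge0 ?sqr_ge0// mulr_ge0 ?sqr_ge0// ltW.
(* E / (y D) is the last coordinate of the projected vector, positive because
   the projection stays in the future cone *)
pose E := D + 2 * a * F.
have E0 : 0 < E.
  have -> : E = ((b + 2 * a * x) ^+ 2 + D + (2 * a * y) ^+ 2) / 2.
    by rewrite /E /F /D; field.
  by rewrite divr_gt0// ltr_wpDr ?sqr_ge0// ltr_wpDl// sqr_ge0.
have nE : E != 0 by rewrite gt_eqF.
have sk0 : 0 < Num.sqrt k by rewrite sqrtr_gt0.
have sk2 : Num.sqrt k ^+ 2 = k by rewrite sqr_sqrtr// ltW.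
have ky : k * y ^+ 2 * D = y ^+ 2 * D + F ^+ 2 by rewrite /k; field; rewrite n1 n3.
exists ((x * D - b * F) / E, Num.sqrt k * y * D / E) => /=.
  split=> /=; first by rewrite divr_gt0// !mulr_gt0.
  have -> : a * (((x * D - b * F) / E) ^+ 2 + (Num.sqrt k * y * D / E) ^+ 2) +
      b * ((x * D - b * F) / E) + c =
    (a * ((x * D - b * F) ^+ 2 + Num.sqrt k ^+ 2 * y ^+ 2 * D * D) +
      b * (x * D - b * F) * E + c * E ^+ 2) / E ^+ 2 by field.
  by rewrite sk2 ky /E /F /D (_ : a * _ + _ + _ = 0) ?mul0r//; ring.
rewrite -[RHS]sk2; congr (_ ^+ 2).
have s0 : Num.sqrt k != 0 by rewrite gt_eqF.
have -> : 1 + ((x - (x * D - b * F) / E) ^+ 2 + (y - Num.sqrt k * y * D / E) ^+ 2) /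
    (2 * y * (Num.sqrt k * y * D / E)) =
  ((x * E - (x * D - b * F)) ^+ 2 + y ^+ 2 * E ^+ 2 + Num.sqrt k ^+ 2 * y ^+ 2 * D * D) /
  (2 * y ^+ 2 * D * E * Num.sqrt k).
  by field; rewrite n1 n3 nE s0.
apply: (mulIf (_ : 2 * y ^+ 2 * D * E * Num.sqrt k != 0)).
  by rewrite !mulf_neq0// expf_neq0.
rewrite divfK; last by rewrite !mulf_neq0// expf_neq0.
have -> : Num.sqrt k * (2 * y ^+ 2 * D * E * Num.sqrt k) =
   2 * E * (Num.sqrt k ^+ 2 * y ^+ 2 * D) by ring.
by rewrite sk2 ky /E /F /D; ring.
Qed.

(** The infimum is a minimum, so it determines hp_fun h z / z.2 on either side
    of the geodesic. *)
Lemma inf_dist_geodesic (R : realType) (h : halfplane R) (z : R * R) :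
  hplane z ->
  inf [set hdist z w | w in geodesic h] = arcosh (Num.sqrt
    (1 + hp_fun h z ^+ 2 / ((hp_b h ^+ 2 - 4 * hp_a h * hp_c h) * z.2 ^+ 2))).
Proof.
move=> z0; set k := (X in Num.sqrt X).
have k1 : 1 <= k.
  by rewrite lerDl divr_ge0 ?sqr_ge0// mulr_ge0 ?sqr_ge0// ltW// hp_disc.
have sk1 : 1 <= Num.sqrt k by rewrite -[leLHS]sqrtr1 ler_wsqrtr.
have lb w : geodesic h w -> arcosh (Num.sqrt k) <= hdist z w.
  move=> hw; have [w0 _] := hw; apply: le_arcosh => //.
  rewrite -[leRHS]ger0_norm ?(le_trans _ (cosh_dist_ge1 z0 w0))// -sqrtr_sqr.
  by apply: ler_wsqrtr; exact: dist_geodesic_ge.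
have [w hw dw] := dist_geodesic_attained h z0.
have [w0 _] := hw.
have dzw : hdist z w = arcosh (Num.sqrt k).
  rewrite /hdist; congr arcosh; rewrite /k -dw sqrtr_sqr ger0_norm//.
  by rewrite (le_trans _ (cosh_dist_ge1 z0 w0)).
apply/eqP; rewrite eq_le; apply/andP; split.
  rewrite -dzw; apply: ge_inf; last by exists w.
  by exists (arcosh (Num.sqrt k)) => _ [v hv <-]; exact: lb.
apply: lb_le_inf; first by exists (hdist z w); exists w.
by move=> _ [v hv <-]; exact: lb.
Qed.

Definition on_circline {R : realType} (A B C D : R) (z : R * R) : Prop :=
  A * (z.1 ^+ 2 + z.2 ^+ 2) + B * z.1 + C * z.2 + D = 0.

Lemma arcosh_inj (R : realType) (u v : R) : 1 <= u -> 1 <= v ->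
  arcosh u = arcosh v -> u = v.
Proof. by move=> u1 v1 uv; rewrite -(cosh_arcosh u1) uv cosh_arcosh. Qed.

(** For the equidistant curve, the distance to the geodesic h determines the
    quotient hp_fun h z / z.2, a constant k on the branch, and
    hp_fun h z = k z.2 is the equation of a circle or a line. *)
Lemma cycle_circline (R : realType) (I : Type) (i0 : I) (K : set (R * R)) (P : I -> R * R) :
  is_circle K \/ is_horocycle K \/ is_equidistant_branch K ->
  (forall i, K (P i)) ->
  exists A B C D : R, ((A != 0) || (C != 0)) /\ forall i, on_circline A B C D (P i).
Proof.
move=> [[u [r [u0 r0 ->]]]|[[[k [k0 ->]]|[xi [rho [rho0 ->]]]]|[h [r [r0 ->]]]]] KP.
- exists 1, (- 2 * u.1), (- 2 * u.2 * cosh r), (u.1 ^+ 2 + u.2 ^+ 2).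
  split=> [|i]; first by rewrite oner_neq0.
  have [y0 /= hi] := KP i; have := cosh_hdist u0 y0.
  rewrite hi /cosh_dist /on_circline => ->.
  by field; move: y0 u0; rewrite /hplane/= => /lt0r_neq0 -> /lt0r_neq0 ->.
- exists 0, 0, 1, (- k); split=> [|i]; first by rewrite oner_neq0 orbT.
  by have /= := KP i; rewrite /on_circline => ->; ring.
- exists 1, (- 2 * xi), (- 2 * rho), (xi ^+ 2).
  split=> [|i]; first by rewrite oner_neq0.
  by have [_ /= hi] := KP i; rewrite /on_circline; lra.
- pose f i := hp_fun h (P i) / (P i).2.
  have y i : 0 < (P i).2 by have [[]] := KP i.
  have F i : 0 < hp_fun h (P i) by have [[]] := KP i.
  have f0 i : 0 < f i by rewrite divr_gt0.
  have feq i : f i = f i0.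
    have d0 := hp_disc h; set d := (X in 0 < X) in d0.
    have hi j : arcosh (Num.sqrt (1 + f j ^+ 2 / d)) = r.
      have [_ /= <-] := KP j; rewrite inf_dist_geodesic; last exact: y.
      congr (arcosh (Num.sqrt (1 + _))).
      by rewrite /f -/d; move: (y j) => yj; field; rewrite !gt_eqF.
    have k1 j : 1 <= 1 + f j ^+ 2 / d.
      by rewrite lerDl divr_ge0 ?sqr_ge0// ltW.
    have s1 j : 1 <= Num.sqrt (1 + f j ^+ 2 / d) by rewrite -[leLHS]sqrtr1 ler_wsqrtr.
    have := arcosh_inj (s1 i) (s1 i0) (etrans (hi i) (esym (hi i0))).
    move=> /(congr1 (fun t => t ^+ 2)); rewrite !sqr_sqrtr ?(le_trans _ (k1 _))//.
    move=> /addrI /(mulIf (invr_neq0 (lt0r_neq0 d0))).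
    by apply: pexpIrn => //; rewrite nnegrE ltW.
  exists (hp_a h), (hp_b h), (- f i0), (hp_c h); split=> [|i].
    by rewrite oppr_eq0 (gt_eqF (f0 i0)) orbT.
  rewrite /on_circline -(feq i) /f mulNr divfK ?gt_eqF//; rewrite /hp_fun; ring.
Qed.

(** * The cross-ratio product of a cyclic quadrilateral *)

(** Real and imaginary parts of
    (z0 - z1) (z2 - z3) conj ((z1 - z2) (z3 - z0)). *)
Definition cross_re {R : realType} (p0 p1 p2 p3 : R * R) : R :=
  ((p0.1 - p1.1) * (p2.1 - p3.1) - (p0.2 - p1.2) * (p2.2 - p3.2)) *
  ((p1.1 - p2.1) * (p3.1 - p0.1) - (p1.2 - p2.2) * (p3.2 - p0.2)) +
  ((p0.1 - p1.1) * (p2.2 - p3.2) + (p0.2 - p1.2) * (p2.1 - p3.1)) *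
  ((p1.1 - p2.1) * (p3.2 - p0.2) + (p1.2 - p2.2) * (p3.1 - p0.1)).

Definition cross_im {R : realType} (p0 p1 p2 p3 : R * R) : R :=
  ((p0.1 - p1.1) * (p2.2 - p3.2) + (p0.2 - p1.2) * (p2.1 - p3.1)) *
  ((p1.1 - p2.1) * (p3.1 - p0.1) - (p1.2 - p2.2) * (p3.2 - p0.2)) -
  ((p0.1 - p1.1) * (p2.1 - p3.1) - (p0.2 - p1.2) * (p2.2 - p3.2)) *
  ((p1.1 - p2.1) * (p3.2 - p0.2) + (p1.2 - p2.2) * (p3.1 - p0.1)).

Definition edist2 {R : realType} (p q : R * R) : R :=
  (p.1 - q.1) ^+ 2 + (p.2 - q.2) ^+ 2.

Lemma cross_norm (R : realType) (p0 p1 p2 p3 : R * R) :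
  cross_re p0 p1 p2 p3 ^+ 2 + cross_im p0 p1 p2 p3 ^+ 2 =
  edist2 p0 p1 * edist2 p1 p2 * edist2 p2 p3 * edist2 p3 p0.
Proof. rewrite /cross_re /cross_im /edist2; ring. Qed.

(** On a line everything is a multiple of a product of differences of
    abscissae, and the product of the two determinants is
    - (p2.1 - p0.1)^2 times the cross-ratio product. *)
Lemma cross_line (R : realType) (p0 p1 p2 p3 : R * R) (m n : R) :
  (forall p, p \in [:: p0; p1; p2; p3] -> p.2 = m * p.1 + n) ->
  0 < gdet p0 p1 p2 * gdet p2 p3 p0 ->
  cross_im p0 p1 p2 p3 = 0 /\ cross_re p0 p1 p2 p3 <= 0.
Proof.
move=> L; have := L p0; have := L p1; have := L p2; have := L p3.
rewrite !inE !eqxx ?orbT => /(_ isT) e3 /(_ isT) e2 /(_ isT) e1 /(_ isT) e0.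
rewrite /gdet /cross_im /cross_re e0 e1 e2 e3 => h.
split; first by ring.
have : 0 <= (p2.1 - p0.1) ^+ 2 by exact: sqr_ge0.
rewrite le_eqVlt => /orP[/eqP z|z0].
  move: h; have -> : p2.1 = p0.1 by apply/eqP; rewrite -subr_eq0 -sqrf_eq0 -z.
  rewrite [X in 0 < X](_ : _ = 0) ?ltxx//; ring.
rewrite -(pmulr_rle0 _ z0) -oppr_ge0; apply: ltW; move: h.
by congr (0 < _); ring.
Qed.

(** The product factors as w1 w2, where w1 and w2 have real parts r1, r2 and
    imaginary parts m1, m2, with arguments the angles at p1 and p3. On a
    circle, gdet is c times the Euclidean orientation determinant, so the
    hypothesis says that m1 and m2 have the same sign; a real product w1 w2 is
    then negative. *)
Lemma cross_circle (R : realType) (p0 p1 p2 p3 : R * R) (b c d : R) :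
  (forall p, p \in [:: p0; p1; p2; p3] ->
    p.1 ^+ 2 + p.2 ^+ 2 = b * p.1 + c * p.2 + d) ->
  0 < gdet p0 p1 p2 * gdet p2 p3 p0 ->
  cross_im p0 p1 p2 p3 = 0 /\ cross_re p0 p1 p2 p3 <= 0.
Proof.
move=> L; have := L p0; have := L p1; have := L p2; have := L p3.
rewrite !inE !eqxx ?orbT => /(_ isT) e3 /(_ isT) e2 /(_ isT) e1 /(_ isT) e0.
rewrite /gdet e0 e1 e2 e3.
pose r1 := (p0.1 - p1.1) * (p2.1 - p1.1) + (p0.2 - p1.2) * (p2.2 - p1.2).
pose m1 := (p0.2 - p1.2) * (p2.1 - p1.1) - (p0.1 - p1.1) * (p2.2 - p1.2).
pose r2 := (p2.1 - p3.1) * (p0.1 - p3.1) + (p2.2 - p3.2) * (p0.2 - p3.2).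
pose m2 := (p2.2 - p3.2) * (p0.1 - p3.1) - (p2.1 - p3.1) * (p0.2 - p3.2).
have -> : cross_re p0 p1 p2 p3 = r1 * r2 - m1 * m2.
  by rewrite /cross_re /r1 /r2 /m1 /m2; ring.
(* the imaginary part is the determinant of the rows (x^2 + y^2, x, y, 1) *)
have im0 : cross_im p0 p1 p2 p3 = 0.
  pose D3 (p q r : R * R) := (q.1 - p.1) * (r.2 - p.2) - (q.2 - p.2) * (r.1 - p.1).
  have : cross_im p0 p1 p2 p3 =
    (p1.1 ^+ 2 + p1.2 ^+ 2) * D3 p2 p3 p0 - (p0.1 ^+ 2 + p0.2 ^+ 2) * D3 p1 p2 p3
    + (p3.1 ^+ 2 + p3.2 ^+ 2) * D3 p0 p1 p2 - (p2.1 ^+ 2 + p2.2 ^+ 2) * D3 p3 p0 p1.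
    by rewrite /cross_im /D3; ring.
  by rewrite e0 e1 e2 e3 => ->; rewrite /D3; ring.
have imE : cross_im p0 p1 p2 p3 = r1 * m2 + m1 * r2.
  by rewrite /cross_im /r1 /r2 /m1 /m2; ring.
move=> h; split => //.
have {}h : 0 < m1 * m2.
  have c0 : 0 <= c ^+ 2 by exact: sqr_ge0.
  have : 0 < c ^+ 2 * (m1 * m2).
    by move: h; congr (0 < _); rewrite /m1 /m2; ring.
  by move: c0; rewrite le_eqVlt => /orP[/eqP <-|c0]; rewrite ?mul0r ?ltxx// pmulr_rgt0.
rewrite -(pmulr_rle0 _ h).
have e : r1 * m2 = - (m1 * r2) by apply/eqP; rewrite -addr_eq0 -imE im0.
have -> : m1 * m2 * (r1 * r2 - m1 * m2) = - ((m1 * r2) ^+ 2 + (m1 * m2) ^+ 2).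
  have -> : m1 * m2 * (r1 * r2 - m1 * m2) = (r1 * m2) * (m1 * r2) - (m1 * m2) ^+ 2.
    by ring.
  by rewrite e; ring.
by rewrite oppr_le0 addr_ge0 ?sqr_ge0.
Qed.

Lemma circline_cross (R : realType) (p0 p1 p2 p3 : R * R) (A B C D : R) :
  (A != 0) || (C != 0) ->
  (forall p, p \in [:: p0; p1; p2; p3] -> on_circline A B C D p) ->
  0 < gdet p0 p1 p2 * gdet p2 p3 p0 ->
  cross_im p0 p1 p2 p3 = 0 /\ cross_re p0 p1 p2 p3 <= 0.
Proof.
rewrite /on_circline; have [->/= C0 L|A0 _ L] := eqVneq A 0.
- apply: (@cross_line _ _ _ _ _ (- B / C) (- D / C)) => p /L h.
  rewrite -[LHS](mulKf C0) (_ : C * p.2 = - B * p.1 - D); [by field|lra].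
- apply: (@cross_circle _ _ _ _ _ (- B / A) (- C / A) (- D / A)) => p /L h.
  rewrite -[LHS](mulKf A0) (_ : A * _ = - B * p.1 - C * p.2 - D); [by field|lra].
Qed.

Lemma prod_edist (R : realType) (p0 p1 p2 p3 : R * R) (A B C D : R) :
  (A != 0) || (C != 0) ->
  (forall p, p \in [:: p0; p1; p2; p3] -> on_circline A B C D p) ->
  0 < gdet p0 p1 p2 * gdet p2 p3 p0 ->
  edist2 p0 p1 * edist2 p1 p2 * edist2 p2 p3 * edist2 p3 p0 =
   cross_re p0 p1 p2 p3 ^+ 2 /\ cross_re p0 p1 p2 p3 <= 0.
Proof.
move=> AC L D0; have [i0 r0] := circline_cross AC L D0.
by rewrite -cross_norm i0 expr0n addr0.
Qed.

(** * Cosine of half the area *)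

Lemma cosh_sqr_half (R : realType) (x : R) : cosh (x / 2) ^+ 2 = (cosh x + 1) / 2.
Proof.
have e : expR x = expR (x / 2) ^+ 2.
  by rewrite -expRM_natl; congr expR; field.
rewrite /cosh !expRN e; field; exact: lt0r_neq0 (expR_gt0 _).
Qed.

Lemma sinh_sqr (R : realType) (x : R) : sinh x ^+ 2 = cosh x ^+ 2 - 1.
Proof.
rewrite /sinh /cosh expRN; field; exact: lt0r_neq0 (expR_gt0 _).
Qed.

Lemma cosh_gt0 (R : realType) (x : R) : 0 < cosh x.
Proof. by rewrite /cosh divr_gt0// addr_gt0// expR_gt0. Qed.

Lemma sinh_ge0 (R : realType) (x : R) : 0 <= x -> 0 <= sinh x.
Proof.
by move=> x0; rewrite /sinh divr_ge0// subr_ge0 ler_expR (le_trans _ x0)// oppr_le0.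
Qed.

Lemma cosh_half_hdist (R : realType) (z w : R * R) : hplane z -> hplane w ->
  cosh (hdist z w / 2) ^+ 2 =
    ((w.1 - z.1) ^+ 2 + (z.2 + w.2) ^+ 2) / (4 * z.2 * w.2).
Proof.
move=> z0 w0; rewrite cosh_sqr_half cosh_hdist// /cosh_dist; field.
by rewrite !gt_eqF.
Qed.

Lemma sinh_half_hdist (R : realType) (z w : R * R) : hplane z -> hplane w ->
  sinh (hdist z w / 2) ^+ 2 = edist2 z w / (4 * z.2 * w.2).
Proof.
move=> z0 w0; rewrite sinh_sqr cosh_half_hdist// /edist2; field.
by rewrite !gt_eqF.
Qed.

(** The complex number (z.2 + w.2) + i (w.1 - z.1) has modulus r. *)
Lemma cos_sin_half_edge_angle (R : realType) (z w : R * R) : hplane z -> hplane w ->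
  let t := (w.1 - z.1) / (z.2 + w.2) in
  let r := 2 * Num.sqrt z.2 * Num.sqrt w.2 * cosh (hdist z w / 2) in
  cos (atan t) = (z.2 + w.2) / r /\ sin (atan t) = (w.1 - z.1) / r.
Proof.
move=> z0 w0 t r; have s0 : 0 < z.2 + w.2 by rewrite addr_gt0.
have c0 := cosh_gt0 (hdist z w / 2); have c2 := cosh_half_hdist z0 w0.
rewrite /r; move: (cosh (hdist z w / 2)) c0 c2 => k k0 k2 {r}.
set r := 2 * _ * _ * k.
have r0 : 0 < r by rewrite /r !mulr_gt0 ?sqrtr_gt0.
have e : Num.sqrt (1 + t ^+ 2) = r / (z.2 + w.2).
  rewrite -[RHS]ger0_norm ?(ltW (divr_gt0 r0 s0))// -sqrtr_sqr; congr Num.sqrt.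
  rewrite expr_div_n {1}/r !exprMn !sqr_sqrtr ?ltW// k2.
  by rewrite /t; field; rewrite !gt_eqF.
have c : cos (atan t) = (z.2 + w.2) / r by rewrite cos_atan e invf_div.
split => //; have : tan (atan t) = t by rewrite atanK.
rewrite /tan => h; have cn : cos (atan t) != 0 by rewrite c gt_eqF// divr_gt0.
rewrite -[LHS](divfK cn) h c /t; field.
by rewrite !gt_eqF.
Qed.

Lemma cosD4_fractions (R : realType) (r0 r1 r2 r3 A0 A1 A2 A3 B0 B1 B2 B3 : R) :
  (A0 / r0 * (A1 / r1) - B0 / r0 * (B1 / r1)) *
  (A2 / r2 * (A3 / r3) - B2 / r2 * (B3 / r3)) -
  (B0 / r0 * (A1 / r1) + A0 / r0 * (B1 / r1)) *
  (B2 / r2 * (A3 / r3) + A2 / r2 * (B3 / r3)) =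
  ((A0 * A1 - B0 * B1) * (A2 * A3 - B2 * B3) -
   (B0 * A1 + A0 * B1) * (B2 * A3 + A2 * B3)) / (r0 * r1 * r2 * r3).
Proof. by rewrite !invfM; ring. Qed.

(** Real part of the product of the four numbers
    (y_j + y_(j+1)) + i (x_(j+1) - x_j), divided by the product of their moduli.
    Expanding the real part produces the squared Euclidean side lengths and the
    cross-ratio product. *)
Lemma cos_edge_angles (R : realType) (p0 p1 p2 p3 : R * R) :
  hplane p0 -> hplane p1 -> hplane p2 -> hplane p3 ->
  let ch p q := cosh (hdist p q / 2) in
  let sh2 p q := sinh (hdist p q / 2) ^+ 2 in
  cos ((edge_angle p0 p1 + edge_angle p1 p2 + edge_angle p2 p3 + edge_angle p3 p0) / 2) =
  (1 + (sh2 p0 p1 + sh2 p1 p2 + sh2 p2 p3 + sh2 p3 p0) / 2 +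
    cross_re p0 p1 p2 p3 / (16 * p0.2 * p1.2 * p2.2 * p3.2)) /
  (ch p0 p1 * ch p1 p2 * ch p2 p3 * ch p3 p0).
Proof.
move=> y0 y1 y2 y3 ch sh2.
have shE p q : hplane p -> hplane q ->
    sh2 p q = edist2 p q / (4 * p.2 * q.2) by exact: sinh_half_hdist.
rewrite !shE//.
have -> : (edge_angle p0 p1 + edge_angle p1 p2 + edge_angle p2 p3 + edge_angle p3 p0) / 2 =
  (atan ((p1.1 - p0.1) / (p0.2 + p1.2)) + atan ((p2.1 - p1.1) / (p1.2 + p2.2))) +
  (atan ((p3.1 - p2.1) / (p2.2 + p3.2)) + atan ((p0.1 - p3.1) / (p3.2 + p0.2))).
  by rewrite /edge_angle; field.
have [c0 s0] := cos_sin_half_edge_angle y0 y1.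
have [c1 s1] := cos_sin_half_edge_angle y1 y2.
have [c2 s2] := cos_sin_half_edge_angle y2 y3.
have [c3 s3] := cos_sin_half_edge_angle y3 y0.
rewrite cosD !sinD !cosD c0 c1 c2 c3 s0 s1 s2 s3; clear c0 c1 c2 c3 s0 s1 s2 s3.
rewrite -/(ch p0 p1) -/(ch p1 p2) -/(ch p2 p3) -/(ch p3 p0).
have k0 : ch p0 p1 != 0 by rewrite gt_eqF// cosh_gt0.
have k1 : ch p1 p2 != 0 by rewrite gt_eqF// cosh_gt0.
have k2 : ch p2 p3 != 0 by rewrite gt_eqF// cosh_gt0.
have k3 : ch p3 p0 != 0 by rewrite gt_eqF// cosh_gt0.
have n0 : p0.2 != 0 by rewrite gt_eqF.
have n1 : p1.2 != 0 by rewrite gt_eqF.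
have n2 : p2.2 != 0 by rewrite gt_eqF.
have n3 : p3.2 != 0 by rewrite gt_eqF.
set r0 := 2 * _ * _ * ch p0 p1; set r1 := 2 * _ * _ * ch p1 p2.
set r2 := 2 * _ * _ * ch p2 p3; set r3 := 2 * _ * _ * ch p3 p0.
(* each vertex occurs in two edges, so the square roots pair up *)
have rr : r0 * r1 * r2 * r3 = 16 * p0.2 * p1.2 * p2.2 * p3.2 *
    (ch p0 p1 * ch p1 p2 * ch p2 p3 * ch p3 p0).
  transitivity (16 * Num.sqrt p0.2 ^+ 2 * Num.sqrt p1.2 ^+ 2 * Num.sqrt p2.2 ^+ 2 *
      Num.sqrt p3.2 ^+ 2 * (ch p0 p1 * ch p1 p2 * ch p2 p3 * ch p3 p0)).
    rewrite /r0 /r1 /r2 /r3; move: (ch p0 p1) (ch p1 p2) (ch p2 p3) (ch p3 p0).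
    by move=> *; ring.
  by rewrite !sqr_sqrtr// ltW.
rewrite cosD4_fractions rr.
have -> : (1 + (edist2 p0 p1 / (4 * p0.2 * p1.2) + edist2 p1 p2 / (4 * p1.2 * p2.2) +
    edist2 p2 p3 / (4 * p2.2 * p3.2) + edist2 p3 p0 / (4 * p3.2 * p0.2)) / 2 +
    cross_re p0 p1 p2 p3 / (16 * p0.2 * p1.2 * p2.2 * p3.2)) =
  (16 * p0.2 * p1.2 * p2.2 * p3.2 + 2 * (edist2 p0 p1 * p2.2 * p3.2 +
     edist2 p1 p2 * p0.2 * p3.2 + edist2 p2 p3 * p0.2 * p1.2 +
     edist2 p3 p0 * p1.2 * p2.2) + cross_re p0 p1 p2 p3) /
  (16 * p0.2 * p1.2 * p2.2 * p3.2).
  move: (edist2 p0 p1) (edist2 p1 p2) (edist2 p2 p3) (edist2 p3 p0) => e0 e1 e2 e3.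
  by field; rewrite n0 n1 n2 n3.
rewrite -[RHS]mulrA -invfM; congr (_ / _).
by rewrite /edist2 /cross_re; ring.
Qed.

(** * The area formula *)

Lemma quarter_exp (R : realType) (a b c d s p q r t : R) :
  s = (a + b + c + d) / 2 ->
  p = expR (a / 4) -> q = expR (b / 4) -> r = expR (c / 4) -> t = expR (d / 4) ->
  [/\ cosh ((s - a) / 2) = (q * r * t / p + p / (q * r * t)) / 2,
      sinh ((s - a) / 2) = (q * r * t / p - p / (q * r * t)) / 2,
      cosh (a / 2) = (p ^+ 2 + p ^- 2) / 2 &
      sinh (a / 2) = (p ^+ 2 - p ^- 2) / 2].
Proof.
move=> -> -> -> -> ->.
have e1 : expR (((a + b + c + d) / 2 - a) / 2) =
    expR (b / 4) * expR (c / 4) * expR (d / 4) / expR (a / 4).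
  by rewrite -expRN -!expRD; congr expR; field.
have e2 : expR (a / 2) = expR (a / 4) ^+ 2.
  by rewrite -expRM_natl; congr expR; field.
by rewrite /cosh /sinh !expRN e1 e2 invf_div; split.
Qed.

(** Identities between Laurent polynomials in exp (a/4), ..., exp (d/4). *)
Lemma prod_half_sums (R : realType) (a b c d s : R) :
  s = (a + b + c + d) / 2 ->
  let K := cosh ((s - a) / 2) * cosh ((s - b) / 2) *
        cosh ((s - c) / 2) * cosh ((s - d) / 2) in
  let H := sinh ((s - a) / 2) * sinh ((s - b) / 2) *
        sinh ((s - c) / 2) * sinh ((s - d) / 2) in
  K + H = cosh (a / 2) * cosh (b / 2) * cosh (c / 2) * cosh (d / 2) +
          sinh (a / 2) * sinh (b / 2) * sinh (c / 2) * sinh (d / 2) /\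
  K - H = 1 + (sinh (a / 2) ^+ 2 + sinh (b / 2) ^+ 2 +
               sinh (c / 2) ^+ 2 + sinh (d / 2) ^+ 2) / 2.
Proof.
move=> hs K H; rewrite /K /H {K H}.
have p0 := expR_gt0 (a / 4); have q0 := expR_gt0 (b / 4).
have r0 := expR_gt0 (c / 4); have t0 := expR_gt0 (d / 4).
have [-> -> -> ->] := quarter_exp hs erefl erefl erefl erefl.
have hb : s = (b + c + d + a) / 2 by lra.
have [-> -> -> ->] := quarter_exp hb erefl erefl erefl erefl.
have hc : s = (c + d + a + b) / 2 by lra.
have [-> -> -> ->] := quarter_exp hc erefl erefl erefl erefl.
have hd : s = (d + a + b + c) / 2 by lra.
have [-> -> -> ->] := quarter_exp hd erefl erefl erefl erefl.
move: (expR (a / 4)) (expR (b / 4)) (expR (c / 4)) (expR (d / 4)) p0 q0 r0 t0.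
move=> p q r t /lt0r_neq0 p0 /lt0r_neq0 q0 /lt0r_neq0 r0 /lt0r_neq0 t0.
split; field; by rewrite p0 q0 r0 t0.
Qed.

Lemma tan_sqr_half (R : realType) (x : R) :
  tan x ^+ 2 = (1 - cos (2 * x)) / (1 + cos (2 * x)).
Proof.
have c : cos (2 * x) = 2 * cos x ^+ 2 - 1.
  by rewrite mulr_natl cos_mulr2n mulr_natl.
rewrite c /tan expr_div_n sin2cos2.
have -> : 1 - (2 * cos x ^+ 2 - 1) = 2 * (1 - cos x ^+ 2) by ring.
have -> : 1 + (2 * cos x ^+ 2 - 1) = 2 * cos x ^+ 2 by ring.
by rewrite -mulf_div divff ?mul1r// pnatr_eq0.
Qed.

(** Both sides are nonnegative and have equal squares. *)
Lemma prod_sinh_half (R : realType) (p0 p1 p2 p3 : R * R) :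
  hplane p0 -> hplane p1 -> hplane p2 -> hplane p3 ->
  edist2 p0 p1 * edist2 p1 p2 * edist2 p2 p3 * edist2 p3 p0 =
    cross_re p0 p1 p2 p3 ^+ 2 ->
  cross_re p0 p1 p2 p3 <= 0 ->
  sinh (hdist p0 p1 / 2) * sinh (hdist p1 p2 / 2) *
  sinh (hdist p2 p3 / 2) * sinh (hdist p3 p0 / 2) =
  - (cross_re p0 p1 p2 p3 / (16 * p0.2 * p1.2 * p2.2 * p3.2)).
Proof.
move=> y0 y1 y2 y3 e c0.
have sh (p q : R * R) : hplane p -> hplane q -> 0 <= sinh (hdist p q / 2).
  by move=> hp hq; rewrite sinh_ge0// divr_ge0// arcosh_ge0// cosh_dist_ge1.
have n : 0 < 16 * p0.2 * p1.2 * p2.2 * p3.2 by rewrite !mulr_gt0.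
have s01 := sinh_half_hdist y0 y1; have s12 := sinh_half_hdist y1 y2.
have s23 := sinh_half_hdist y2 y3; have s30 := sinh_half_hdist y3 y0.
move: (sh _ _ y0 y1) (sh _ _ y1 y2) (sh _ _ y2 y3) (sh _ _ y3 y0) s01 s12 s23 s30.
move: (sinh (hdist p0 p1 / 2)) (sinh (hdist p1 p2 / 2)).
move: (sinh (hdist p2 p3 / 2)) (sinh (hdist p3 p0 / 2)).
move=> s2 s3 s0 s1 g0 g1 g2 g3 s01 s12 s23 s30.
apply: (@pexpIrn _ 2) => //.
- by rewrite nnegrE !mulr_ge0.
- by rewrite nnegrE -mulNr divr_ge0 ?oppr_ge0// ltW.
rewrite sqrrN expr_div_n -e !exprMn s01 s12 s23 s30.
by field; rewrite !gt_eqF.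
Qed.

Lemma prod_tanh4 (R : realType) (x y z w : R) :
  tanh x * tanh y * tanh z * tanh w =
  sinh x * sinh y * sinh z * sinh w / (cosh x * cosh y * cosh z * cosh w).
Proof. 
rewrite /tanh; move: (sinh x) (cosh x) (sinh y) (cosh y) (sinh z) (cosh z).
by move: (sinh w) (cosh w) => *; rewrite !mulf_div.
 Qed.

(** Knowing S up to sign is enough: the two orientations of the vertices give
    opposite sums of edge angles, with the same cosine. *)
Lemma cyclic_quadrangle_area (R : realType) (p0 p1 p2 p3 : R * R)
    (A B C D a b c d s eps S : R) :
  hplane p0 -> hplane p1 -> hplane p2 -> hplane p3 ->
  (A != 0) || (C != 0) ->
  (forall p, p \in [:: p0; p1; p2; p3] -> on_circline A B C D p) ->
  0 < gdet p0 p1 p2 * gdet p2 p3 p0 ->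
  cos (S / 2) = cos ((edge_angle p0 p1 + edge_angle p1 p2 +
                      edge_angle p2 p3 + edge_angle p3 p0) / 2) ->
  a = hdist p0 p1 -> b = hdist p1 p2 -> c = hdist p2 p3 -> d = hdist p3 p0 ->
  s = (a + b + c + d) / 2 ->
  eps = (sinh (a / 2) * sinh (b / 2) * sinh (c / 2) * sinh (d / 2)) /
       (cosh ((s - a) / 2) * cosh ((s - b) / 2) *
        cosh ((s - c) / 2) * cosh ((s - d) / 2)) ->
  tan (S / 4) ^+ 2 =
    1 / (1 - eps) *
    (tanh ((s - a) / 2) * tanh ((s - b) / 2) *
     tanh ((s - c) / 2) * tanh ((s - d) / 2)).
Proof.
move=> y0 y1 y2 y3 AC L D0 cosS ea eb ec ed hs heps.
have [e r0] := prod_edist AC L D0.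
have sg := prod_sinh_half y0 y1 y2 y3 e r0.
have := cos_edge_angles y0 y1 y2 y3; rewrite /= -cosS -[X in _ + X](opprK (_ / _)) -sg.
rewrite -ea -eb -ec -ed; clear e r0 sg cosS ea eb ec ed.
have [KH KmH] := prod_half_sums hs.
have k0 : 0 < cosh (a / 2) * cosh (b / 2) * cosh (c / 2) * cosh (d / 2).
  by repeat first [exact: cosh_gt0|apply: mulr_gt0].
have K0 : 0 < cosh ((s - a) / 2) * cosh ((s - b) / 2) *
  cosh ((s - c) / 2) * cosh ((s - d) / 2) by repeat first [exact: cosh_gt0|apply: mulr_gt0].
have -> : tan (S / 4) ^+ 2 = (1 - cos (S / 2)) / (1 + cos (S / 2)).
  by rewrite tan_sqr_half (_ : 2 * (S / 4) = S / 2)//; field.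
rewrite prod_tanh4 heps -KmH.
move: KH K0 k0; clear.
set Sg := sinh (a / 2) * _ * _ * _; set k := cosh (a / 2) * _ * _ * _.
set K := cosh _ * _ * _ * _; set H := sinh _ * _ * _ * _.
move: K H k Sg (cos _) => K H k Sg cs KH K0 k0 ->.
have kE : k = K + H - Sg by lra.
have n : k != 0 by rewrite gt_eqF.
have nK : K != 0 by rewrite gt_eqF.
have -> : 1 - (K - H - Sg) / k = 2 * H / k by rewrite kE in n *; field.
have -> : 1 + (K - H - Sg) / k = 2 * (K - Sg) / k by rewrite kE in n *; field.
have -> : 1 - Sg / K = (K - Sg) / K by field.
(* if K = Sg then both sides are 0 through division by 0 *)
have [->|z] := eqVneq (K - Sg) 0; first by rewrite !(mulr0, mul0r, invr0).
by field; rewrite n z nK.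
Qed.

Theorem theorem4p3 (R : realType) (Q : set (R * R)) (P : 'I_4 -> R * R)
    (a b c d s eps S : R)
    (hQ : cyclic_polygon Q P)
    (ha : a = side_length P 0) (hb : b = side_length P 1)
    (hc : c = side_length P 2) (hd : d = side_length P 3)
    (hs : s = (a + b + c + d) / 2)
    (heps : eps =
       (sinh (a / 2) * sinh (b / 2) * sinh (c / 2) * sinh (d / 2)) /
       (cosh ((s - a) / 2) * cosh ((s - b) / 2) *
        cosh ((s - c) / 2) * cosh ((s - d) / 2)))
    (hS : S = harea Q) :
  tan (S / 4) ^+ 2 =
    1 / (1 - eps) *
    (tanh ((s - a) / 2) * tanh ((s - b) / 2) *
     tanh ((s - c) / 2) * tanh ((s - d) / 2)).
Proof.
have [/convex_quadrangle[y QE] [K [hK KP]]] := hQ.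
have [A [B [C [D [AC onC]]]]] := cycle_circline (0 : 'I_4) hK KP.
have [S0 S1 S2 S3] := ordS_I4.
rewrite /side_length S0 in ha; rewrite /side_length S1 in hb.
rewrite /side_length S2 in hc; rewrite /side_length S3 in hd.
have L p : p \in [:: P 0; P 1; P 2; P 3] -> on_circline A B C D p.
  by rewrite !inE => /or4P[] /eqP ->.
have fineE (T : set (R * R)) (r : R) : hvol T = r%:E -> harea T = r by rewrite /harea /Rintegral -/(hvol T) => ->.
apply: (cyclic_quadrangle_area (y 0) (y 1) (y 2) (y 3) AC L _ _ ha hb hc hd hs heps).
- case: QE => [[[D0 D1 D2 D3] _]|[[D0 D1 D2 D3] _]]; first exact: mulr_gt0.
  rewrite -mulrNN -!gdetC mulr_gt0//; first by rewrite -gdet_cycle.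
  by rewrite -gdet_cycle.
- case: QE => [[[D0 D1 D2 D3] QE]|[[D0 D1 D2 D3] QE]]; rewrite hS QE.
    by rewrite (fineE _ _ (hvol_quadrangle (y 0) (y 1) (y 2) (y 3) D0 D1 D2 D3)).
  rewrite (fineE _ _ (hvol_quadrangle (y 3) (y 2) (y 1) (y 0) D0 D1 D2 D3)) -cosN.
  rewrite (edge_angleC (P 2)) (edge_angleC (P 1)) (edge_angleC (P 0)) (edge_angleC (P 3) (P 0)).
  by congr cos; field.
Qed.
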